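(* Let $L$ be a real-valued functional defined on the finite subsets of $[0,1]^2$, and assume that for a certain constant $\kappa$ the following regularity condition holds: whenever $F\subset[0,1]^2$ is finite, $k\ge 1$, $C\in\mathcal C_k$, $G\subset C$ is finite, and there is a point of $F$ within distance $2^{-k+2}$ of $C$, then $$L(F)\le L(F\cup G)\le L(F)+\kappa2^{-k}\sqrt{\mathrm{card}\,G}.$$ Then there is a constant $K$ depending only on $\kappa$ such that, for every $N\ge1$, if $X_1,\dots,X_N$ are independent and uniformly distributed over $[0,1]^2$, the random variable $L_N=L(\{X_1,\dots,X_N\})$ satisfies, for each $t\ge0$, $$P(|L_N-M|\ge t)\le Ke^{-t^2/K},$$ where $M$ is a median of $L_N$.
   Context: For $k\ge1$, $\mathcal C_k$ denotes the family of the $2^{2k}$ dyadic squares of side $2^{-k}$ contained in $[0,1]^2$, i.e. those whose vertices are of the form $(\ell_12^{-k},\ell_22^{-k})$ with integers $0\le\ell_1,\ell_2\le2^k$. Distances are Euclidean. All functions are treated as measurable. *)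

(* Defs.v *)
From mathcomp Require Export all_boot all_order all_algebra.
From mathcomp Require Export finmap all_classical all_reals all_analysis.
Export Order.TTheory GRing.Theory Num.Theory.
Export numFieldNormedType.Exports.
Set Implicit Arguments.
Unset Strict Implicit.
Unset Printing Implicit Defensive.

Local Open Scope classical_set_scope.
Local Open Scope ring_scope.

Definition point_set (R : realType) (n : nat) (x : 'I_n -> R * R) :
  {fset R * R} := [fset x i | i in 'I_n]%fset.

Definition unit_square (R : realType) : set (R * R) := `[0, 1] `*` `[0, 1].

Definition eucl_dist (R : realType) (p q : R * R) : R :=
  Num.sqrt ((p.1 - q.1) ^+ 2 + (p.2 - q.2) ^+ 2).

Definition dyadic_square (R : realType) (k l1 l2 : nat) : set (R * R) :=
  `[l1%:R * 2 ^- k, l1.+1%:R * 2 ^- k] `*`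
  `[l2%:R * 2 ^- k, l2.+1%:R * 2 ^- k].

Definition dyadic_squares (R : realType) (k : nat) : set (set (R * R)) :=
  [set C | exists l1 l2 : 'I_(2 ^ k), C = dyadic_square k l1 l2].

(* [L] is total on [{fset R * R}], but only its values on finite subsets of
   the unit square are constrained. *)
Definition regular (R : realType) (kappa : R) (L : {fset R * R} -> R) : Prop :=
  forall (F G : {fset R * R}) (k : nat) (C : set (R * R)),
    [set` F] `<=` @unit_square R ->
    (1 <= k)%N ->
    dyadic_squares k C ->
    [set` G] `<=` C ->
    (exists2 p, p \in F & exists2 q, C q & eucl_dist p q <= 4 * 2 ^- k) ->
    L F <= L (F `|` G)%fset /\
    L (F `|` G)%fset <= L F + kappa * 2 ^- k * Num.sqrt #|` G|%:R.

(* Measurability of (x_1, ..., x_N) |-> L {x_1, ..., x_N} on the N-th power of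
   the unit square, with respect to the Borel product sigma-algebra. *)
Definition measurable_functional (R : realType) (N : nat)
    (L : {fset R * R} -> R) : Prop :=
  measurable_fun
    [set x : N.-tuple (R * R) | forall i, unit_square (tnth x i)]
    (fun x : N.-tuple (R * R) => L (point_set (tnth x))).

Definition mutually_independent d d' (T : measurableType d)
    (E : measurableType d') (R : realType) (P : probability T R) (I : finType)
    (X : I -> {RV P >-> E}) : Prop :=
  forall (J : {set I}) (A : I -> set E),
    (forall i, i \in J -> measurable (A i)) ->
    P (\bigcap_(i in [set` J]) (X i @^-1` A i)) =
    (\prod_(i in J) P (X i @^-1` A i))%E.

(* Besides having the uniform law, [X] takes its values in the unit square
   everywhere and not just almost surely, since functionals of finite subsets of
   the square are not meaningful elsewhere. *)
Definition uniform_on_unit_square d (T : measurableType d) (R : realType)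
    (P : probability T R) (X : {RV P >-> (R * R)%type}) : Prop :=
  (forall w, unit_square (X w)) /\
  (forall A : set (R * R), measurable A ->
    distribution P X A =
    (@lebesgue_measure R \x @lebesgue_measure R)%E (A `&` @unit_square R)).

Definition is_median d (T : measurableType d) (R : realType)
    (P : probability T R) (Y : T -> R) (M : R) : Prop :=
  ((2^-1)%:E <= P [set w | (Y w <= M)%R])%E /\
  ((2^-1)%:E <= P [set w | (M <= Y w)%R])%E.

(* Main.v *)
(** [L] is Lipschitz in each point, so the points may be rounded to a fine dyadic
grid, and it suffices to prove a deviation inequality about the mean [E] for [N]
independent uniform points of a finite set.  The points are exposed one by one.
When [r] points are still to come, the conditional increment due to a point [x]
is at most [kappa] times the side of the smallest dyadic cell of [x] that meets
the other points; its square has conditional mean at most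
  [kappa^2 (4^-J + 4 sum_k 4^-k (1 - 4^-k)^r A_k)],
where [A_k] is the fraction of level-[k] cells missed by the points already
exposed.  As this also bounds the increment by a multiple of [kappa / sqrt r],
exponential moments of order [l] are controlled as long as [r >= C l^2 kappa^2].
The last [m ~ t^2 / kappa^2] points change [L] by at most [2 kappa sqrt m] and are
never exposed.  Over the first half of the points the variances add up to
[O(kappa^2)]; over the second half they add up to
[kappa^2 (1 + 4 sum_k exp (- m 4^-k) A_k)] with [A_k] evaluated at half-time.
The logarithm of the exponential moments of the number [4^k A_k] of missed cells
is at most a multiple of [4^k exp (- N 4^-k / 4)], and Hölder's inequality over the
levels [k] bounds the exponential moment of that sum. *)

Require Import Defs.
From mathcomp Require Import ring lra zify measurable_realfun.

Set Implicit Arguments.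
Unset Strict Implicit.
Unset Printing Implicit Defensive.

Local Open Scope ring_scope.

(** * Iterated averages over a finite set *)

Section Averages.
Variables (R : realType) (Q : finType).
Hypothesis Q_gt0 : (0 < #|Q|)%N.
Implicit Types (g : Q -> R) (G : seq Q -> R) (s : seq Q).

Definition avg g : R := (\sum_x g x) / #|Q|%:R.

(** The conditional expectation of [G] given the exposed points [s] when [n] uniform points are
    still to come. *)
Fixpoint expect n G s : R :=
  if n is n'.+1 then avg (fun x => expect n' G (x :: s)) else G s.

Let cardQ_neq0 : #|Q|%:R != 0 :> R.
Proof. by rewrite pnatr_eq0 -lt0n. Qed.

Lemma avg_le g h : (forall x, g x <= h x) -> avg g <= avg h.
Proof. by move=> gh; rewrite ler_wpM2r ?invr_ge0//; apply: ler_sum. Qed.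

Lemma eq_avg g h : g =1 h -> avg g = avg h.
Proof. by move=> gh; congr (_ / _); apply: eq_bigr. Qed.

Lemma avg_cst a : avg (fun=> a) = a.
Proof. by rewrite /avg sumr_const -(mulr_natr a) mulfK// cardQ_neq0. Qed.

Lemma avgD g h : avg (fun x => g x + h x) = avg g + avg h.
Proof. by rewrite /avg big_split mulrDl. Qed.

Lemma avgZ a g : avg (fun x => a * g x) = a * avg g.
Proof. by rewrite /avg -mulr_sumr mulrA. Qed.

Lemma avgB g h : avg (fun x => g x - h x) = avg g - avg h.
Proof.
rewrite avgD; congr (_ + _).
by rewrite (@eq_avg _ (fun x => -1 * h x)) ?avgZ ?mulN1r// => x; rewrite mulN1r.
Qed.

Lemma avg_sum I (r : seq I) (F : I -> Q -> R) :
  avg (fun x => \sum_(i <- r) F i x) = \sum_(i <- r) avg (F i).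
Proof. by rewrite /avg exchange_big mulr_suml. Qed.

Lemma avg_ge0 g : (forall x, 0 <= g x) -> 0 <= avg g.
Proof. by move=> g0; rewrite -(avg_cst 0); apply: avg_le. Qed.

Lemma avg_sqr g : avg g ^+ 2 <= avg (fun x => g x ^+ 2).
Proof.
have := avg_ge0 (fun x => sqr_ge0 (g x - avg g)).
rewrite (@eq_avg _ (fun x => g x ^+ 2 - 2 * avg g * g x + avg g ^+ 2)); last first.
  by move=> x; ring.
rewrite avgD avgB avgZ avg_cst; nra.
Qed.

Lemma expect_le_cat n G H s :
  (forall t, size t = n -> G (t ++ s) <= H (t ++ s)) ->
  expect n G s <= expect n H s.
Proof.
elim: n s => [|n IH] s GH /=; first exact: (GH [::]).
apply: avg_le => x; apply: IH => t st.
by rewrite -cat_rcons; apply: GH; rewrite size_rcons st.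
Qed.

Lemma expect_le n G H s : (forall t, G t <= H t) -> expect n G s <= expect n H s.
Proof. by move=> GH; apply: expect_le_cat. Qed.

Lemma eq_expect n G H s : G =1 H -> expect n G s = expect n H s.
Proof.
by move=> GH; apply/eqP; rewrite eq_le !expect_le// => t; rewrite GH.
Qed.

Lemma expect_cst n a s : expect n (fun=> a) s = a.
Proof.
by elim: n s => //= n IH s; rewrite (eq_avg (fun x => IH _)) avg_cst.
Qed.

Lemma expectD n G H s :
  expect n (fun t => G t + H t) s = expect n G s + expect n H s.
Proof.
by elim: n s => //= n IH s; rewrite (eq_avg (fun x => IH _)) avgD.
Qed.

Lemma expectZ n a G s : expect n (fun t => a * G t) s = a * expect n G s.
Proof.
by elim: n s => //= n IH s; rewrite (eq_avg (fun x => IH _)) avgZ.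
Qed.

Lemma expectB n G H s :
  expect n (fun t => G t - H t) s = expect n G s - expect n H s.
Proof.
by elim: n s => //= n IH s; rewrite (eq_avg (fun x => IH _)) avgB.
Qed.

Lemma expect_sum n I (r : seq I) (F : I -> seq Q -> R) s :
  expect n (fun t => \sum_(i <- r) F i t) s = \sum_(i <- r) expect n (F i) s.
Proof.
elim: n s => //= n IH s; rewrite (eq_avg (fun x => IH _)).
exact: avg_sum.
Qed.

Lemma expect_sqr n G s : expect n G s ^+ 2 <= expect n (fun t => G t ^+ 2) s.
Proof.
elim: n s => //= n IH s; apply: (le_trans (avg_sqr _)).
exact: avg_le.
Qed.

Lemma expect_comp n p G s : expect (n + p) G s = expect n (expect p G) s.
Proof. by elim: n s => //= n IH s; apply: eq_avg => x; rewrite IH. Qed.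

Definition set_invariant G := forall s s', s =i s' -> G s = G s'.

Lemma expect_set_invariant n G : set_invariant G -> set_invariant (expect n G).
Proof.
move=> Ginv; elim: n => //= n IH s s' ss'; apply: eq_avg => x.
by apply: IH => y; rewrite !inE ss'.
Qed.

(** Moving [x] past the [n] later points couples the expectations with and without [x] through the
    same later points. *)
Lemma expect_cons n G x s : set_invariant G ->
  expect n G (x :: s) = expect n (fun t => G (x :: t)) s.
Proof.
move=> Ginv; elim: n s => //= n IH s; apply: eq_avg => y; rewrite -IH.
by apply: expect_set_invariant => // z; rewrite !inE orbCA.
Qed.

(** The iterated averages become a count of tuples, the form in which the law of the rounded sample
    is estimated. *)
Lemma expect_tuple n G s : set_invariant G ->
  expect n G s = (\sum_(t : n.-tuple Q) G (t ++ s)) / (#|Q| ^ n)%:R.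
Proof.
move=> Ginv; elim: n s => [|n IH] s /=.
  rewrite (big_pred1 [tuple]) ?expn0 ?divr1// => t.
  by apply/esym/eqP/val_inj; rewrite /= (tuple0 t).
rewrite (eq_avg (fun x => IH _)) /avg -mulr_suml -mulrA -invfM -natrM mulnC -expnS.
congr (_ / _); rewrite pair_big /=.
rewrite [RHS](reindex (fun p : Q * n.-tuple Q => [tuple of p.1 :: p.2])) /=.
  apply: eq_bigr => -[x t] _ /=; apply: Ginv => y.
  by rewrite mem_cat !inE mem_cat orbCA.
exists (fun t => (thead t, [tuple of behead t])) => /= [[x t] _|t _].
  by congr pair; rewrite ?theadE//; apply: val_inj.
by rewrite -tuple_eta.
Qed.

End Averages.

(** * Elementary exponential inequalities *)

Section ExponentialBounds.
Variable R : realType.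
Implicit Types (x y : R).

(** From [expR (- y) >= 1 - y] follows [expR y <= (1 - y)^-1], and [(1 - y) * (1 + y + 2 * y ^+ 2) =
    1 + y ^+ 2 * (1 - 2 * y)] is at least 1. *)
Lemma expR_le_quadratic y : y <= 2^-1 -> expR y <= 1 + y + 2 * y ^+ 2.
Proof.
move=> y2; have := expR_ge1Dx (- y); rewrite expRN => h.
have y1 : 0 < 1 - y by lra.
apply: (@le_trans _ _ (1 - y)^-1).
  by rewrite -[leLHS]invrK lef_pV2 ?posrE ?invr_gt0 ?expR_gt0.
rewrite -[leLHS]mul1r ler_pdivrMr//; nra.
Qed.

Lemma expRN_le_inv y : 0 <= y -> expR (- y) <= (1 + y)^-1.
Proof.
move=> y0; rewrite expRN lef_pV2 ?posrE ?expR_gt0 ?expR_ge1Dx//; lra.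
Qed.

Lemma expRN_le_inv_sqr y : 0 <= y -> expR (- y) <= 4 / (1 + y) ^+ 2.
Proof.
move=> y0; have -> : - y = 2%:R * (- (y / 2)) by field.
rewrite expRM_natl.
have h : expR (- (y / 2)) <= 2 / (1 + y).
  apply: (le_trans (expRN_le_inv _)); first by lra.
  rewrite -[leLHS]mul1r ler_pdivrMr; last by lra.
  rewrite mulrAC ler_pdivlMr; lra.
apply: (le_trans (lerXn2r 2 _ _ h)); rewrite ?nnegrE ?expR_ge0//.
  by rewrite divr_ge0//; lra.
by rewrite expr_div_n; lra.
Qed.

Lemma one_sub_exp_le_expR x n : x <= 1 -> (1 - x) ^+ n <= expR (- (n%:R * x)).
Proof.
move=> x1; rewrite -mulrN expRM_natl lerXn2r ?nnegrE ?expR_ge0 ?expR_ge1Dx//.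
lra.
Qed.

Lemma sum_geometric_le x m n : 0 <= x <= 1 ->
  \sum_(m <= r < m + n) x * (1 - x) ^+ r <= (1 - x) ^+ m.
Proof.
move=> /andP[x0 x1].
suff -> : \sum_(m <= r < m + n) x * (1 - x) ^+ r = (1 - x) ^+ m - (1 - x) ^+ (m + n).
  by rewrite gerBl exprn_ge0//; lra.
elim: n => [|n IH]; first by rewrite addn0 big_geq// subrr.
by rewrite addnS big_nat_recr ?leq_addr//= IH exprS; ring.
Qed.

Lemma pow4_le1 k : 0 < (4 : R) ^- k <= 1.
Proof. by rewrite invr_gt0 exprn_gt0// invf_le1 ?exprn_gt0// exprn_ege1//; lra. Qed.

(* With [g y = y / (1 + y)], the summand is at most a multiple of
   [g (4 y) - g y], so that the sum over a geometric progression telescopes. *)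
Lemma sum_dyadic_expR_le x J : 0 <= x ->
  \sum_(1 <= k < J.+1) x * 4 ^- k * expR (- (x * 4 ^- k)) <= 16 / 3.
Proof.
move=> x0; pose g k := x * 4 ^- k / (1 + x * 4 ^- k).
have y0 k : 0 <= x * 4 ^- k by rewrite mulr_ge0// ltW//; case/andP: (pow4_le1 k).
suff h : \sum_(1 <= k < J.+1) x * 4 ^- k * expR (- (x * 4 ^- k)) <=
         16 / 3 * (g 0%N - g J).
  apply: (le_trans h); have : 0 <= g J by rewrite /g divr_ge0// addr_ge0.
  have : g 0%N <= 1 by rewrite /g ler_pdivrMr ?mul1r; have := y0 0%N; lra.
  by lra.
elim: J => [|J IH]; first by rewrite big_geq// subrr mulr0.
rewrite big_nat_recr//=.
have e : x * 4 ^- J = 4 * (x * 4 ^- J.+1).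
  by rewrite exprS invfM; field; rewrite expf_neq0//; lra.
suff: x * 4 ^- J.+1 * expR (- (x * 4 ^- J.+1)) <= 16 / 3 * (g J - g J.+1) by lra.
rewrite /g e; have := y0 J.+1; set y := x * _ => hy.
apply: (@le_trans _ _ (y * (4 / (1 + y) ^+ 2))).
  by rewrite ler_wpM2l// expRN_le_inv_sqr.
rewrite -subr_ge0.
have -> : 16 / 3 * (4 * y / (1 + 4 * y) - y / (1 + y)) - y * (4 / (1 + y) ^+ 2) =
   12 * y / ((1 + 4 * y) * (1 + y) ^+ 2).
  by field; rewrite !lt0r_neq0//; lra.
by rewrite divr_ge0 ?mulr_ge0 ?exprn_ge0//; lra.
Qed.

Lemma sum_exp4_le J : \sum_(1 <= k < J.+1) (4 : R) ^+ k <= 4 / 3 * 4 ^+ J.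
Proof.
elim: J => [|J IH]; first by rewrite big_geq// expr0; lra.
by rewrite big_nat_recr//= exprS; have := exprn_ge0 J (ler0n R 4); lra.
Qed.

(** The tangent line of [expR] at the weighted mean [a] lies below it, and its weighted average is
    [expR a]. *)
Lemma expR_jensen I (r : seq I) (p y : I -> R) :
  (forall i, 0 <= p i) -> \sum_(i <- r) p i = 1 ->
  expR (\sum_(i <- r) p i * y i) <= \sum_(i <- r) p i * expR (y i).
Proof.
move=> p0 p1; set a := \sum_(i <- r) p i * y i.
apply: (@le_trans _ _ (\sum_(i <- r) p i * (expR a * (1 + (y i - a))))); last first.
  apply: ler_sum => i _; rewrite ler_wpM2l//.
  rewrite -[in leRHS](subrK a (y i)) expRD mulrC.
  by rewrite ler_wpM2r ?expR_ge0 ?expR_ge1Dx.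
rewrite (eq_bigr (fun i => expR a * (p i * y i) + (expR a * (1 - a)) * p i)); last first.
  by move=> i _; ring.
by rewrite big_split/= -!mulr_sumr p1 -/a le_eqVlt; apply/orP; left; apply/eqP; ring.
Qed.

(** One of [a], [- a], [b], [- b] is at least [t / 4], and its exponential alone compensates the
    prefactor. This is a pointwise Chernoff bound. *)
Lemma one_le_sum_expR (l t a b : R) : 0 < l -> t / 2 <= `|a + b| ->
  1 <= expR (- (l * t / 4)) *
    (expR (l * a) + expR (- l * a) + (expR (l * b) + expR (- l * b))).
Proof.
move=> l0; have pos v : t / 4 <= v -> 1 <= expR (- (l * t / 4)) * expR (l * v).
  move=> tv; rewrite -expRD -[leLHS](expR0 R) ler_expR.
  by have := ler_wpM2l (ltW l0) tv; lra.
have neg v : t / 4 <= - v -> 1 <= expR (- (l * t / 4)) * expR (- l * v).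
  by move=> /pos; rewrite mulrN mulNr.
have c0 := expR_ge0 (- (l * t / 4)).
have e1 := mulr_ge0 c0 (expR_ge0 (l * a)); have e2 := mulr_ge0 c0 (expR_ge0 (- l * a)).
have e3 := mulr_ge0 c0 (expR_ge0 (l * b)); have e4 := mulr_ge0 c0 (expR_ge0 (- l * b)).
rewrite !mulrDr.
have [/pos|a1] := lerP (t / 4) a; first by lra.
have [/neg|a2] := lerP (t / 4) (- a); first by lra.
have [/pos|b1] := lerP (t / 4) b; first by lra.
have [/neg|b2] := lerP (t / 4) (- b); first by lra.
move=> ab; have : `|a + b| < t / 2 by rewrite ltr_norml; lra.
by lra.
Qed.

(* The exponential is compared with a quadratic, so that the variance proxy is
   the second moment of [a] and not the square of its maximum. *)
Lemma avg_expR_centered (Q : finType) (a : Q -> R) (l : R) : (0 < #|Q|)%N ->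
  (forall q, 0 <= a q) -> (forall q, `|l| * a q <= 2^-1) ->
  avg (fun q => expR (l * (a q - avg a))) <=
    expR (2 * l ^+ 2 * avg (fun q => a q ^+ 2)).
Proof.
move=> Q0 a0 al; set m := avg a; have m0 : 0 <= m by apply: avg_ge0.
have ml : `|l| * m <= 2^-1 by rewrite /m -avgZ -(avg_cst Q0 2^-1); apply: avg_le.
apply: (@le_trans _ _ (avg (fun q => 1 + l * (a q - m) + 2 * (l * (a q - m)) ^+ 2))).
  apply: avg_le => q; apply: expR_le_quadratic.
  have la := ler_norm l; have lN : - l <= `|l| by rewrite -normrN ler_norm.
  have := a0 q; have := al q; have := normr_ge0 l.
  by case: (lerP (a q) m); nra.
rewrite (@eq_avg _ _ _ (fun q => (1 - l * m + 2 * l ^+ 2 * m ^+ 2) +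
     ((l - 4 * l ^+ 2 * m) * a q + 2 * l ^+ 2 * (a q ^+ 2)))); last first.
  by move=> q; ring.
rewrite avgD avg_cst// avgD !avgZ -/m; set v := avg _.
apply: le_trans (expR_ge1Dx _); have := sqr_ge0 (l * m); nra.
Qed.

End ExponentialBounds.

(** * Dyadic cells missed by the exposed points *)

Section EmptyCells.
Variables (R : realType) (Q : finType) (T : eqType) (cell : nat -> Q -> T).
Variable J : nat.
Hypothesis Q_gt0 : (0 < #|Q|)%N.
Hypothesis avg_cell : forall k x, (k <= J)%N ->
  avg (fun y => (cell k y == cell k x)%:R) = 4 ^- k :> R.
Implicit Types (s : seq Q) (x y : Q) (k : nat).

Definition cell_empty k s x : R := (all (fun y => cell k y != cell k x) s)%:R.

(** The [A_k] of the overview. Cells have equal mass, so [4 ^+ k * empty_fraction k s] counts the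
    level-[k] cells missed by [s]. *)
Definition empty_fraction k s : R := avg (cell_empty k s).

Lemma cell_empty_ge0 k s x : 0 <= cell_empty k s x.
Proof. exact: ler0n. Qed.

Lemma cell_empty_le1 k s x : cell_empty k s x <= 1.
Proof. by rewrite /cell_empty; case: all. Qed.

Lemma cell_empty_cons k y s x :
  cell_empty k (y :: s) x = (1 - (cell k y == cell k x)%:R) * cell_empty k s x.
Proof. by rewrite /cell_empty /=; case: eqP => _ /=; rewrite ?subrr ?mul0r ?subr0 ?mul1r. Qed.

Lemma empty_fraction_ge0 k s : 0 <= empty_fraction k s.
Proof. by apply: avg_ge0 => // x; exact: cell_empty_ge0. Qed.

Lemma empty_fraction_le1 k s : empty_fraction k s <= 1.
Proof. by rewrite -(avg_cst Q_gt0 1); apply: avg_le => x; exact: cell_empty_le1. Qed.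

(** A new point [y] affects only its own cell, on which [cell_empty k s] is constant: one cell is
    lost if it was empty, none otherwise. *)
Lemma empty_fraction_cons k y s : (k <= J)%N ->
  empty_fraction k (y :: s) = empty_fraction k s - 4 ^- k * cell_empty k s y.
Proof.
move=> kJ; rewrite /empty_fraction -(avg_cell y kJ) mulrC -avgZ -avgB.
apply: eq_avg => x; rewrite cell_empty_cons (eq_sym (cell k x)).
have [e|_] := eqVneq (cell k y) (cell k x); last by rewrite subr0 mul1r mulr0 subr0.
by rewrite subrr mul0r mulr1 /cell_empty e subrr.
Qed.

Lemma expect_cell_empty k r s x : (k <= J)%N ->
  expect r (fun t => cell_empty k t x) s = (1 - 4 ^- k) ^+ r * cell_empty k s x.
Proof.
move=> kJ; elim: r s => [|r IH] s /=; first by rewrite expr0 mul1r.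
rewrite (@eq_avg _ _ _ (fun y => (1 - 4 ^- k) ^+ r * cell_empty k s x *
   (1 - (cell k y == cell k x)%:R))); last first.
  by move=> y; rewrite IH cell_empty_cons; ring.
by rewrite avgZ avgB avg_cst// avg_cell// exprS; ring.
Qed.

(** One exposure hits an empty cell with probability [A] and then lowers their number by one. As
    [e <= 1], the averaged factor [1 - (1 - expR (- e)) * A] is at most [expR (- (e / 2 * A))], so
    each step multiplies the parameter by [1 - 4 ^- k / 2]. *)
Lemma expect_expR_empty_fraction k n s (th : R) : (k <= J)%N -> 0 <= th <= 1 ->
  expect n (fun t => expR (th * (4 ^+ k * empty_fraction k t))) s <=
  expR (th * (1 - 4 ^- k / 2) ^+ n * (4 ^+ k * empty_fraction k s)).
Proof.
move=> kJ /andP[th0 th1]; have /andP[u0 u1] := pow4_le1 R k.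
elim: n s => [|n IH] s /=; first by rewrite expr0 mulr1.
apply: le_trans; first by apply: avg_le => x; exact: IH.
set q := 1 - _; set e := th * q ^+ n.
have q1 : 0 <= q <= 1 by rewrite /q; apply/andP; split; lra.
have /andP[qn0 qn1] : 0 <= q ^+ n <= 1 by rewrite exprn_ge0 ?exprn_ile1//; case/andP: q1.
have e01 : 0 <= e <= 1 by rewrite /e mulr_ge0// mulr_ile1.
have k4 : (4 : R) ^+ k * 4 ^- k = 1 by rewrite mulfV// expf_neq0//; lra.
rewrite (@eq_avg _ _ _ (fun x => expR (e * (4 ^+ k * empty_fraction k s)) *
    (1 - (1 - expR (- e)) * cell_empty k s x))); last first.
  move=> x; rewrite empty_fraction_cons// (mulrBr (4 ^+ k)) (mulrA _ (4 ^- k)) k4 mul1r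
    mulrBr expRD.
  congr (_ * _); rewrite /cell_empty; case: all; rewrite ?mulr1 ?mulr0 ?oppr0 ?expR0; ring.
rewrite avgZ avgB avg_cst// avgZ -/(empty_fraction k s); set A := empty_fraction k s.
apply: (@le_trans _ _ (expR (e * (4 ^+ k * A)) * expR (- ((1 - expR (- e)) * A)))).
  by rewrite ler_wpM2l ?expR_ge0// expR_ge1Dx.
rewrite -expRD ler_expR exprSr (mulrA th) -/e.
have A0 : 0 <= A := empty_fraction_ge0 k s.
have he : e / 2 <= 1 - expR (- e).
  case/andP: e01 => e0 e1; have := expRN_le_inv e0.
  have : (1 + e)^-1 <= 1 - e / 2.
    rewrite -[leLHS]mul1r ler_pdivrMr; [nra|lra].
  lra.
have -> : e * q * (4 ^+ k * A) = e * (4 ^+ k * A) - e / 2 * A.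
  transitivity (e * (4 ^+ k * A) - e / 2 * (4 ^+ k * 4 ^- k) * A).
    by rewrite /q; field; rewrite expf_neq0//; lra.
  by rewrite k4 mulr1.
by rewrite lerD2l lerN2 ler_wpM2r.
Qed.

(* Hölder's inequality with the weights [p k] proportional to
   [m 4^-k exp (- m 4^-k)], in the form of Jensen's inequality for [exp] applied
   to the exponents recentered by [b k]. *)
Lemma expect_expR_sum_empty_fraction n m (mu : R) :
    (0 < J)%N -> (0 < n)%N -> (0 < m)%N -> 0 <= mu -> 16 / 3 * mu <= m%:R ->
  expect n (fun t => expR (mu * \sum_(1 <= k < J.+1)
      expR (- (m%:R * 4 ^- k)) * empty_fraction k t)) [::] <=
  expR (mu * (8 / 3 * 4 ^+ J / n%:R)).
Proof.
move=> J0 n0 m0 mu0 mum.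
have nR : 0 < n%:R :> R by rewrite ltr0n.
have mR : 0 < m%:R :> R by rewrite ltr0n.
have u0 k : 0 < (4 : R) ^- k by case/andP: (pow4_le1 R k).
have u1 k : (4 : R) ^- k <= 1 by case/andP: (pow4_le1 R k).
pose w k : R := m%:R * 4 ^- k * expR (- (m%:R * 4 ^- k)).
have w0 k : 0 < w k by rewrite /w !mulr_gt0 ?expR_gt0.
pose Z := \sum_(1 <= k < J.+1) w k.
have Z1 : Z <= 16 / 3 by apply: sum_dyadic_expR_le; rewrite ltW.
have Z0 : 0 < Z.
  by rewrite /Z big_ltn// ltr_pwDl// sumr_ge0// => k _; apply: ltW.
pose p k := w k / Z; have p0 k : 0 <= p k by rewrite divr_ge0// ltW.
have p1 : \sum_(1 <= k < J.+1) p k = 1 by rewrite -mulr_suml divff// lt0r_neq0.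
(* One parameter serves all levels: [p k * th * 4 ^+ k] is the wanted coefficient
   [mu * expR (- (m%:R * 4 ^- k))]. The bounds on [Z] and [mu] give [th <= 1]. *)
pose th := mu * Z / m%:R.
have th01 : 0 <= th <= 1.
  rewrite /th divr_ge0 ?mulr_ge0 ?(ltW Z0)//= ler_pdivrMr//; nra.
pose b k := th * ((1 - 4 ^- k / 2) ^+ n * 4 ^+ k).
have pw k : p k * th * 4 ^+ k = mu * expR (- (m%:R * 4 ^- k)).
  have k0 : (4 : R) ^+ k != 0 by rewrite expf_neq0//; lra.
  rewrite /p /th /w; field.
  by rewrite k0 !lt0r_neq0.
have le1 t : expR (mu * \sum_(1 <= k < J.+1)
      expR (- (m%:R * 4 ^- k)) * empty_fraction k t) <=
   expR (\sum_(1 <= k < J.+1) p k * b k) * \sum_(1 <= k < J.+1)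
     (p k * expR (- b k)) * expR (th * (4 ^+ k * empty_fraction k t)).
  have -> : mu * \sum_(1 <= k < J.+1) expR (- (m%:R * 4 ^- k)) * empty_fraction k t =
    \sum_(1 <= k < J.+1) p k * b k + \sum_(1 <= k < J.+1) p k *
      (th * (4 ^+ k * empty_fraction k t) - b k).
    rewrite -big_split/= mulr_sumr; apply: eq_bigr => k _.
    by rewrite mulrA -pw; ring.
  rewrite expRD ler_wpM2l ?expR_ge0//; apply: (le_trans (expR_jensen _ p0 p1)).
  by apply: ler_sum => k _; rewrite expRD mulrA mulrAC.
apply: le_trans; first by apply: expect_le => t; exact: le1.
rewrite expectZ expect_sum//.
apply: (@le_trans _ _ (expR (\sum_(1 <= k < J.+1) p k * b k) * \sum_(1 <= k < J.+1) p k)).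
  rewrite ler_wpM2l ?expR_ge0//; rewrite !big_seq; apply: ler_sum => k.
  rewrite mem_index_iota => /andP[_ kJ]; rewrite expectZ.
  have kJ' : (k <= J)%N by lia.
  have := expect_expR_empty_fraction n [::] kJ' th01.
  have -> : empty_fraction k [::] = 1 by rewrite /empty_fraction avg_cst.
  rewrite mulr1 -mulrA -/(b k) => h.
  rewrite -mulrA ler_piMr// -[leRHS](expR0 R) -(addNr (b k)) expRD.
  by rewrite ler_wpM2l ?expR_ge0.
rewrite p1 mulr1 ler_expR.
apply: (@le_trans _ _ (\sum_(1 <= k < J.+1) mu * (2 * 4 ^+ k / n%:R))); last first.
  rewrite -mulr_sumr ler_wpM2l// -mulr_suml -mulr_sumr ler_wpM2r ?invr_ge0//.
  by have := sum_exp4_le R J; lra.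
apply: ler_sum => k _.
have -> : p k * b k = mu * (expR (- (m%:R * 4 ^- k)) * (1 - 4 ^- k / 2) ^+ n).
  by rewrite mulrA -pw /b; ring.
rewrite ler_wpM2l//.
apply: (@le_trans _ _ ((1 - 4 ^- k / 2) ^+ n)).
  rewrite ler_piMl//.
    by rewrite exprn_ge0//; have := u1 k; have := u0 k; lra.
apply: (le_trans (one_sub_exp_le_expR _ _)); first by have := u1 k; lra.
have y0 : 0 < n%:R * (4 ^- k / 2) :> R by rewrite !mulr_gt0.
apply: (le_trans (expRN_le_inv (ltW y0))).
have -> : 2 * 4 ^+ k / n%:R = (n%:R * (4 ^- k / 2))^-1 :> R.
  by field; rewrite expf_neq0 ?lt0r_neq0//; lra.
by rewrite lef_pV2 ?posrE//; lra.
Qed.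

End EmptyCells.

(* [m] is the number of points left unexposed at the end of the martingale, and
   [l] is the parameter of the exponential moments. *)
Lemma deviation_parameters (R : realType) (kap t : R) : 0 < kap -> 8 * kap <= t ->
  exists (m : nat) (l : R), [/\ (0 < m)%N, 0 < l,
    64 * (kap ^+ 2 * m%:R) <= t ^+ 2, 92 * (l ^+ 2 * kap ^+ 2) <= m%:R &
    258 * (l ^+ 2 * kap ^+ 2) - l * t / 4 <= - (t ^+ 2 / (16512 * kap ^+ 2))].
Proof.
move=> kap0 tk; have k20 : 0 < kap ^+ 2 by rewrite exprn_gt0.
have t0 : 0 < t by lra.
have [w tw] : exists w, t ^+ 2 = w * kap ^+ 2.
  by exists (t ^+ 2 / kap ^+ 2); rewrite divfK ?lt0r_neq0.
have w64 : 64 <= w by rewrite -(ler_pM2r k20) -tw; nra.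
(* [m] is the integer part of [w / 64]; since [w / 64 >= 1], rounding loses at most a factor 2. *)
have [m [m0 mw wm]] : exists m, [/\ (0 < m)%N, m%:R <= w / 64 & w <= 128 * m%:R].
  have : 0 <= w / 64 by lra.
  move=> /truncn_itv /andP[]; set m := Num.truncn _ => mw wm; exists m.
  have m0 : (0 < m)%N.
    by rewrite lt0n; apply/eqP => e; move: wm; rewrite e; lra.
  split=> //; have : 1 <= m%:R :> R by rewrite (ler_nat _ 1).
  by move: wm; rewrite -(natr1 m); lra.
(* The numeral is kept behind [c]: [field] would expand it in unary. *)
have [c cE] : exists c : R, c = 2064 by exists 2064.
have c_gt0 : 0 < c by rewrite cE ltr0n.
have c_neq0 : c != 0 by rewrite lt0r_neq0.
(* The minimizer in [l] of [258 * (l ^+ 2 * kap ^+ 2) - l * t / 4] is [t / (8 * 258 * kap ^+ 2)] and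
   the minimum is [- (t ^+ 2 / (64 * 258 * kap ^+ 2))]; hence 2064 and 16512. *)
exists m, (t / (c * kap ^+ 2)); set l := t / _.
have ez : l ^+ 2 * kap ^+ 2 = w / 2064 / 2064.
  by rewrite -!cE /l expr_div_n tw; field; rewrite c_neq0 lt0r_neq0.
have -> : l * t / 4 = w / 2064 / 4.
  by rewrite -cE /l (mulrAC t) -expr2 tw; field; rewrite c_neq0 lt0r_neq0.
have -> : t ^+ 2 / (16512 * kap ^+ 2) = w / 16512.
  by rewrite tw invfM mulrACA divff ?lt0r_neq0// mulr1.
rewrite ez tw; split=> //; [by rewrite divr_gt0// mulr_gt0| |lra|lra].
by rewrite mulrCA mulrC ler_pM2r//; lra.
Qed.

(** * Concentration for independent uniform points of a finite set *)

Section FiniteConcentration.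
Variables (R : realType) (Q : finType) (T : eqType) (cell : nat -> Q -> T).
Variables (J N : nat) (kap : R) (f : seq Q -> R).
Hypothesis Q_gt0 : (0 < #|Q|)%N.
Hypothesis avg_cell : forall k x, (k <= J)%N ->
  avg (fun y => (cell k y == cell k x)%:R) = 4 ^- k :> R.
Hypothesis cell0 : forall x y, cell 0 x = cell 0 y.
Hypothesis kap_gt0 : 0 < kap.
Hypothesis f_inv : set_invariant f.
Hypothesis f_cons : forall k x s, (k <= J)%N ->
  has (fun y => cell k y == cell k x) s -> f s <= f (x :: s) <= f s + kap * 2 ^- k.
Hypothesis f_cat : forall t s, s != [::] ->
  f s <= f (t ++ s) <= f s + 2 * kap * Num.sqrt (size t)%:R.
Hypothesis N_gt0 : (0 < N)%N.
(** With between [N] and [4 * N] cells at the finest level, [4 ^- J] sums to at most 1 over [N]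
    steps while [4 ^+ J] stays comparable to the number of points. *)
Hypothesis N_le : (N <= 4 ^ J)%N.
Hypothesis le_N : (4 ^ J <= 4 * N)%N.
Implicit Types (s : seq Q) (x y : Q) (k : nat).

Let u0 k : 0 < (4 : R) ^- k. Proof. by case/andP: (pow4_le1 R k). Qed.
Let u1 k : (4 : R) ^- k <= 1. Proof. by case/andP: (pow4_le1 R k). Qed.

Let f_cons0 x s : s != [::] -> f s <= f (x :: s) <= f s + kap.
Proof.
case: s => // y s _; have := @f_cons 0 x (y :: s) (leq0n _).
by rewrite expr0 invr1 mulr1; apply; rewrite /= (cell0 y x) eqxx.
Qed.

(** Induction on the level. If the cell of [x] at level [j.+1] is occupied, [f_cons] applies there;
    if it is empty, its term [4 * 4 ^- j.+1 = 4 ^- j] makes up for the bound of level [j]. *)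
Lemma f_increment_sqr_le s x : s != [::] ->
  (f (x :: s) - f s) ^+ 2 <=
  kap ^+ 2 * (4 ^- J + 4 * \sum_(1 <= k < J.+1) 4 ^- k * cell_empty R cell k s x).
Proof.
move=> s0; suff: forall j, (j <= J)%N -> (f (x :: s) - f s) ^+ 2 <=
  kap ^+ 2 * (4 ^- j + 4 * \sum_(1 <= k < j.+1) 4 ^- k * cell_empty R cell k s x).
  by apply.
elim=> [_|j IH jJ].
  rewrite big_geq// mulr0 addr0 expr0 invr1 mulr1.
  by have /andP[] := f_cons0 x s0; have := kap_gt0; nra.
rewrite big_nat_recr//= (mulrDr 4).
have sum0 : 0 <= \sum_(1 <= k < j.+1) 4 ^- k * cell_empty R cell k s x.
  by apply: sumr_ge0 => k _; rewrite mulr_ge0 ?cell_empty_ge0// ltW.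
have e4 : 4 * 4 ^- j.+1 = 4 ^- j :> R.
  by rewrite exprS invfM mulrA divff ?mul1r//; lra.
case: (boolP (has (fun y => cell j.+1 y == cell j.+1 x) s)) => [h|].
  have /andP[h1 h2] := f_cons jJ h.
  apply: (@le_trans _ _ ((kap * 2 ^- j.+1) ^+ 2)).
    by rewrite lerXn2r ?nnegrE//; lra.
  have e2 : 2 ^- j.+1 ^+ 2 = 4 ^- j.+1 :> R.
    by rewrite exprVn -exprM mulnC exprM; congr ((_ ^+ _)^-1); rewrite expr2; lra.
  rewrite exprMn e2 ler_pM2l ?exprn_gt0//.
  have := @cell_empty_ge0 R Q T cell j.+1 s x; have := u0 j.+1.
  by nra.
rewrite -all_predC => h.
have -> : cell_empty R cell j.+1 s x = 1 by rewrite /cell_empty h.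
rewrite mulr1; apply: (le_trans (IH (ltnW jJ))); rewrite ler_pM2l ?exprn_gt0// e4.
by have := u0 j.+1; lra.
Qed.

(** The effect of an additional point [x], with [r] points to come in both terms. Subtracting its
    average over [x] gives the martingale difference. *)
Definition increment r s x := expect r f (x :: s) - expect r f s.

Lemma incrementE r s x :
  increment r s x = expect r (fun t => f (x :: t) - f t) s.
Proof. by rewrite /increment expectB expect_cons. Qed.

Let cat_neq0 r (t s : seq Q) : (0 < r)%N -> size t = r -> t ++ s != [::].
Proof. by move=> r0 st; rewrite -size_eq0 size_cat st; lia. Qed.

Lemma increment_ge0 r s x : (0 < r)%N -> 0 <= increment r s x.
Proof.
move=> r0; rewrite incrementE -[leLHS](expect_cst Q_gt0 r 0 s).
apply: expect_le_cat => // t st; rewrite subr_ge0.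
by have /andP[] := f_cons0 x (cat_neq0 s r0 st).
Qed.

(** Jensen's inequality moves the square inside the average over the [r] later points, and an empty
    cell stays empty with probability [(1 - 4 ^- k) ^+ r]. *)
Lemma increment_sqr_le_cells r s x : (0 < r)%N ->
  increment r s x ^+ 2 <= kap ^+ 2 *
    (4 ^- J + 4 * \sum_(1 <= k < J.+1) 4 ^- k * ((1 - 4 ^- k) ^+ r * cell_empty R cell k s x)).
Proof.
move=> r0; rewrite incrementE; apply: (le_trans (expect_sqr _ _ _ _)) => //.
apply: le_trans.
  apply: (@expect_le_cat _ _ _ _ (fun t => kap ^+ 2 *
     (4 ^- J + 4 * \sum_(1 <= k < J.+1) 4 ^- k * cell_empty R cell k t x))) => t st.
  exact: f_increment_sqr_le (cat_neq0 s r0 st).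
rewrite expectZ ler_pM2l ?exprn_gt0// expectD expect_cst// expectZ expect_sum//.
rewrite le_eqVlt; apply/orP; left; apply/eqP; congr (_ + 4 * _).
apply: eq_big_nat => k /andP[_ kJ]; rewrite expectZ.
by rewrite (expect_cell_empty Q_gt0 avg_cell).
Qed.

Lemma sum_dyadic_decay_le r : (0 < r <= N)%N ->
  4 ^- J + 4 * \sum_(1 <= k < J.+1) 4 ^- k * (1 - 4 ^- k) ^+ r <= 23 / r%:R :> R.
Proof.
move=> /andP[r0 rN]; have rR : 0 < r%:R :> R by rewrite ltr0n.
have h1 : 4 ^- J <= r%:R^-1 :> R.
  by rewrite lef_pV2 ?posrE ?exprn_gt0// -natrX ler_nat; lia.
have h2 : \sum_(1 <= k < J.+1) 4 ^- k * (1 - 4 ^- k) ^+ r <= 16 / 3 / r%:R :> R.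
  rewrite ler_pdivlMr// mulr_suml.
  apply: le_trans (sum_dyadic_expR_le J (ltW rR)).
  apply: ler_sum => k _; rewrite mulrC mulrA ler_pM2l ?mulr_gt0//.
  exact: one_sub_exp_le_expR.
(* [1 + 4 * (16 / 3) = 67 / 3 <= 23]. *)
have : 0 < r%:R^-1 :> R by rewrite invr_gt0.
by move: h1 h2; set v := _^-1; lra.
Qed.

(** The dependence on [s] is kept because the uniform bound [23 * kap ^+ 2 / r%:R] would sum to a
    logarithm over the second half of the points. *)
Definition variance_proxy r s : R := kap ^+ 2 *
  (4 ^- J + 4 * \sum_(1 <= k < J.+1) 4 ^- k * ((1 - 4 ^- k) ^+ r * empty_fraction R cell k s)).

Let decay_ge0 k r : 0 <= (1 - 4 ^- k) ^+ r :> R.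
Proof. by rewrite exprn_ge0// subr_ge0. Qed.

Lemma avg_increment_sqr_le r s : (0 < r)%N ->
  avg (fun x => increment r s x ^+ 2) <= variance_proxy r s.
Proof.
move=> r0; apply: le_trans.
  by apply: avg_le => x; exact: increment_sqr_le_cells.
rewrite avgZ ler_pM2l ?exprn_gt0// avgD avg_cst// avgZ avg_sum.
rewrite le_eqVlt; apply/orP; left; apply/eqP; congr (_ + 4 * _).
by apply: eq_bigr => k _; rewrite !avgZ.
Qed.

Lemma variance_proxy_cons r s x : variance_proxy r (x :: s) <= variance_proxy r s.
Proof.
rewrite /variance_proxy ler_pM2l ?exprn_gt0// lerD2l ler_pM2l//.
rewrite !big_seq; apply: ler_sum => k.
rewrite mem_index_iota => /andP[_ kJ]; rewrite !ler_wpM2l ?decay_ge0 ?(ltW (u0 _))//.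
rewrite (empty_fraction_cons avg_cell)// gerBl.
by rewrite mulr_ge0 ?cell_empty_ge0// ltW.
Qed.

Lemma variance_proxy_le r s : (0 < r <= N)%N ->
  variance_proxy r s <= 23 * kap ^+ 2 / r%:R.
Proof.
move=> rN; rewrite -mulrA mulrCA; rewrite ler_pM2l ?exprn_gt0//.
apply: le_trans (sum_dyadic_decay_le rN); rewrite lerD2l ler_pM2l//.
apply: ler_sum => k _; rewrite ler_pM2l// ler_piMr//.
exact: empty_fraction_le1.
Qed.

Lemma increment_sqr_le_inv r s x : (0 < r <= N)%N ->
  increment r s x ^+ 2 <= 23 * kap ^+ 2 / r%:R.
Proof.
move=> /[dup] rN /andP[r0 _]; apply: (le_trans (increment_sqr_le_cells _ _ _)) => //.
rewrite -mulrA mulrCA; rewrite ler_pM2l ?exprn_gt0//.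
apply: le_trans (sum_dyadic_decay_le rN); rewrite lerD2l ler_pM2l//.
apply: ler_sum => k _; rewrite ler_pM2l// ler_piMr//.
exact: cell_empty_le1.
Qed.

(** The one-step bound [avg_expR_centered] is iterated. Exposing points only decreases the proxies
    of later steps, so all of them may be frozen at the initial [s]. *)
Lemma expect_expR_martingale r n s (l : R) : (0 < r)%N -> (n + r <= N)%N ->
    92 * (l ^+ 2 * kap ^+ 2) <= r%:R ->
  expect n (fun t => expR (l * (expect r f t - expect (n + r) f s))) s <=
  expR (2 * l ^+ 2 * \sum_(r <= i < r + n) variance_proxy i s).
Proof.
have l2 : 0 <= 2 * l ^+ 2 by have := sqr_ge0 l; lra.
move=> r0 nrN lr; elim: n s nrN => [|n IH] s nrN /=.
  by rewrite subrr mulr0 expR0 addn0 big_geq// mulr0 expR0.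
set h := avg (fun x => expect (n + r) f (x :: s)).
set V := \sum_(r <= i < r + n) variance_proxy i s.
have hD : h = avg (increment (n + r) s) + expect (n + r) f s.
  by rewrite -[X in _ + X](avg_cst Q_gt0) -avgD; apply: eq_avg => x; rewrite subrK.
apply: (@le_trans _ _ (avg (fun x => expR (2 * l ^+ 2 * V) *
     expR (l * (increment (n + r) s x - avg (increment (n + r) s)))))).
  apply: avg_le => x.
  apply: (@le_trans _ _ (expR (l * (increment (n + r) s x - avg (increment (n + r) s))) *
    expect n (fun t => expR (l * (expect r f t - expect (n + r) f (x :: s)))) (x :: s))).
    rewrite -expectZ; apply: expect_le => t.
    rewrite -expRD hD /increment le_eqVlt; apply/orP; left; apply/eqP; congr expR.
    by set e := avg _; ring.
  rewrite mulrC ler_wpM2r ?expR_ge0//; apply: (le_trans (IH _ _)); first by lia.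
  rewrite ler_expR ler_wpM2l//.
  by rewrite /V; apply: ler_sum => i _; exact: variance_proxy_cons.
rewrite avgZ addnS big_nat_recr ?leq_addr//= -/V mulrDr expRD ler_wpM2l ?expR_ge0//.
have nr0 : (0 < n + r)%N by lia.
apply: (le_trans (avg_expR_centered _ _ _)) => //.
- by move=> x; exact: increment_ge0.
(* After squaring, the bound 1/2 follows from [4 * 23 * (l ^+ 2 * kap ^+ 2) <= r%:R]; this is the
   origin of 92. *)
- move=> x; rewrite -(@ler_pXn2r _ 2) ?nnegrE ?mulr_ge0 ?increment_ge0//.
  have nrR : 0 < (n + r)%:R :> R by rewrite ltr0n.
  have rN : (0 < n + r <= N)%N by lia.
  have hd := increment_sqr_le_inv s x rN; rewrite exprMn real_normK ?num_real//.
  apply: (@le_trans _ _ (l ^+ 2 * (23 * kap ^+ 2 / (n + r)%:R))).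
    by rewrite ler_wpM2l ?sqr_ge0.
  have -> : l ^+ 2 * (23 * kap ^+ 2 / (n + r)%:R) =
     23 * (l ^+ 2 * kap ^+ 2) / (n + r)%:R by ring.
  rewrite ler_pdivrMr// natrD; have := ler0n R n.
  by move: lr; set z := l ^+ 2 * _; lra.
- by rewrite ler_expR ler_wpM2l// addnC avg_increment_sqr_le// addnC.
Qed.

(** At each of these [n <= N - n] steps at least [N - n] points are to come, so the proxies add up
    to at most [23 * kap ^+ 2]. *)
Lemma expect_expR_first_half n (l : R) : (n <= N - n)%N -> (n < N)%N ->
    92 * (l ^+ 2 * kap ^+ 2) <= (N - n)%:R ->
  expect n (fun t => expR (l * (expect (N - n) f t - expect N f [::]))) [::] <=
  expR (46 * (l ^+ 2 * kap ^+ 2)).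
Proof.
move=> nN nlt lN; have r0 : (0 < N - n)%N by rewrite subn_gt0.
have nrN : (n + (N - n) = N)%N by rewrite subnKC// ltnW.
have := @expect_expR_martingale (N - n) n [::] l r0.
rewrite nrN leqnn => /(_ isT lN) h; apply: (le_trans h); rewrite ler_expR.
have rR : 0 < (N - n)%:R :> R by rewrite ltr0n.
apply: (@le_trans _ _ (2 * l ^+ 2 * \sum_(N - n <= i < N - n + n) 23 * kap ^+ 2 / (N - n)%:R)).
  rewrite ler_wpM2l ?mulrn_wge0//; first by have := sqr_ge0 l; lra.
  rewrite !big_seq; apply: ler_sum => i; rewrite mem_index_iota => /andP[i1 i2].
  apply: (le_trans (variance_proxy_le _ _)); first by lia.
  rewrite ler_pM2l ?mulr_gt0 ?exprn_gt0// lef_pV2 ?posrE ?ler_nat// ltr0n; lia.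
rewrite sumr_const_nat addKn.
have nN' : n%:R / (N - n)%:R <= 1 :> R.
  by rewrite ler_pdivrMr// mul1r ler_nat.
have -> : 2 * l ^+ 2 * (23 * kap ^+ 2 / (N - n)%:R *+ n) =
   46 * (l ^+ 2 * kap ^+ 2) * (n%:R / (N - n)%:R).
  by rewrite -mulr_natr; ring.
have : 0 <= l ^+ 2 * kap ^+ 2 by rewrite mulr_ge0 ?sqr_ge0.
by set z := l ^+ 2 * _; nra.
Qed.

(** Summed over [i] first, the geometric series of level [k] is at most [(1 - 4 ^- k) ^+ m], and the
    constant terms give [n * 4 ^- J <= 1]. *)
Lemma sum_variance_proxy_le m n s : (n <= N)%N ->
  \sum_(m <= i < m + n) variance_proxy i s <= kap ^+ 2 *
    (1 + 4 * \sum_(1 <= k < J.+1) expR (- (m%:R * 4 ^- k)) * empty_fraction R cell k s).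
Proof.
move=> nN; rewrite -mulr_sumr ler_pM2l ?exprn_gt0// big_split/= -mulr_sumr.
apply: lerD.
  rewrite sumr_const_nat addKn -(mulr_natl (4 ^- J)) ler_pdivrMr ?exprn_gt0// mul1r.
  by rewrite -natrX ler_nat; lia.
rewrite ler_pM2l// exchange_big/=; apply: ler_sum => k _.
rewrite (eq_bigr (fun i => 4 ^- k * (1 - 4 ^- k) ^+ i * empty_fraction R cell k s)); last first.
  by move=> i _; rewrite mulrA.
rewrite -mulr_suml ler_wpM2r ?empty_fraction_ge0//.
apply: le_trans (one_sub_exp_le_expR m (u1 k)); apply: sum_geometric_le.
by rewrite u1 ltW.
Qed.

(** The proxies are frozen at the first [n1] points [s]; there remains the exponential moment over
    [s] of the weighted empty fractions. *)
Lemma expect_expR_second_half n1 n2 m (l : R) :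
    (n1 + (n2 + m) = N)%N -> (1 < N)%N -> (0 < m)%N -> (N <= 3 * n1)%N ->
    92 * (l ^+ 2 * kap ^+ 2) <= m%:R ->
  expect n1 (fun s => expect n2 (fun t =>
    expR (l * (expect m f t - expect (n2 + m) f s))) s) [::] <=
  expR (258 * (l ^+ 2 * kap ^+ 2)).
Proof.
move=> eN N1 m0 n1N lm; set z := l ^+ 2 * kap ^+ 2.
have z0 : 0 <= z by rewrite mulr_ge0 ?sqr_ge0.
have J0 : (0 < J)%N by case: (J) N_le => //; rewrite expn0; lia.
have n10 : (0 < n1)%N by lia.
apply: (@le_trans _ _ (expR (2 * z) * expect n1 (fun t => expR (8 * z *
   \sum_(1 <= k < J.+1) expR (- (m%:R * 4 ^- k)) * empty_fraction R cell k t)) [::])).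
  rewrite -expectZ; apply: expect_le => s.
  apply: (le_trans (expect_expR_martingale _ m0 _ lm)); first by lia.
  rewrite -expRD ler_expR.
  have h : 0 <= 2 * l ^+ 2 by have := sqr_ge0 l; lra.
  apply: (le_trans (ler_wpM2l h (sum_variance_proxy_le m s _))); first by lia.
  by rewrite le_eqVlt; apply/orP; left; apply/eqP; rewrite /z; ring.
have zm : 16 / 3 * (8 * z) <= m%:R by move: lm; rewrite -/z; lra.
apply: (@le_trans _ _ (expR (2 * z) * expR (8 * z * (8 / 3 * 4 ^+ J / n1%:R)))).
  rewrite ler_wpM2l ?expR_ge0//.
  by apply: (expect_expR_sum_empty_fraction Q_gt0 avg_cell) => //; lra.
rewrite -expRD ler_expR.
(* [4 ^ J <= 4 * N <= 12 * n1], and [2 + 64 / 3 * 12 = 258]. *)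
have : 4 ^+ J / n1%:R <= 12 :> R.
  by rewrite ler_pdivrMr ?ltr0n// -natrX -natrM ler_nat; lia.
have -> : 8 * z * (8 / 3 * 4 ^+ J / n1%:R) = 64 / 3 * z * (4 ^+ J / n1%:R) by ring.
by set w := 4 ^+ J / _; nra.
Qed.

(** Both lists are cut down to single points [x] and [y], which are compared through the pair of
    them. *)
Let f_oscillation s s' : size s = N -> size s' = N ->
  f s <= f s' + 3 * kap * Num.sqrt N%:R.
Proof.
case/lastP: s => [|s x]; first by move=> /= h; move: N_gt0; rewrite -h.
case/lastP: s' => [|s' y]; first by move=> _ /= h; move: N_gt0; rewrite -h.
rewrite !size_rcons => hs hs'.
have x0 : [:: x] != [::] by []. have y0 : [:: y] != [::] by [].
have /andP[_ h1] := f_cat s x0; have /andP[h2 _] := f_cat s' y0.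
have /andP[h3 _] := f_cons0 y x0; have /andP[_ h4] := f_cons0 x y0.
have h5 : f [:: x; y] = f [:: y; x] by apply: f_inv => z; rewrite !inE orbC.
have h6 : Num.sqrt (size s)%:R <= Num.sqrt N%:R :> R.
  by rewrite ler_wsqrtr// ler_nat -hs.
have h7 : 1 <= Num.sqrt N%:R :> R.
  by rewrite -[leLHS]sqrtr1 ler_wsqrtr// (ler_nat _ 1).
by rewrite -!cats1; move: h1 h2 h3 h4 h6 h7 kap_gt0; rewrite h5; nra.
Qed.

Let expect_f_cat m s : s != [::] ->
  f s <= expect m f s <= f s + 2 * kap * Num.sqrt m%:R.
Proof.
move=> s0; apply/andP; split.
  rewrite -[leLHS](expect_cst Q_gt0 m (f s) s); apply: expect_le_cat => t st.
  by have /andP[] := f_cat t s0.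
rewrite -[leRHS](expect_cst Q_gt0 m _ s); apply: expect_le_cat => t st.
by have /andP[] := f_cat t s0; rewrite st.
Qed.

Let deviation (t : R) s : R := (t <= `|f s - expect N f [::]|)%R%:R.

Let dev_eq0 (t : R) : 3 * kap * Num.sqrt N%:R < t -> expect N (deviation t) [::] = 0.
Proof.
move=> tN; rewrite -[RHS](expect_cst Q_gt0 N 0 [::]); apply/eqP; rewrite eq_le.
apply/andP; split; last by apply: expect_le => s; exact: ler0n.
apply: expect_le_cat => s sN; rewrite cats0 /deviation.
suff : `|f s - expect N f [::]| < t by rewrite ltNge => /negbTE ->.
apply: le_lt_trans tN; set c := 3 * kap * _.
have h1 : f s - c <= expect N f [::].
  rewrite -[leLHS](expect_cst Q_gt0 N _ [::]); apply: expect_le_cat => t' tN'.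
  by rewrite cats0 lerBlDr f_oscillation.
have h2 : expect N f [::] <= f s + c.
  rewrite -[leRHS](expect_cst Q_gt0 N _ [::]); apply: expect_le_cat => t' tN'.
  by rewrite cats0 f_oscillation.
by rewrite ler_norml; lra.
Qed.

(** With [m] points unexposed, the deviation is [a + b] up to [t / 4], where [b] comes from the
    first half of the points and [a] from the second. The four exponentials of [one_le_sum_expR] are
    averaged separately. *)
Lemma finite_concentration (t : R) : 8 * kap <= t ->
  expect N (fun s => (t <= `|f s - expect N f [::]|)%R%:R) [::] <=
  4 * expR (- (t ^+ 2 / (16512 * kap ^+ 2))).
Proof.
move=> tk; have t0 : 0 < t by have := kap_gt0; lra.
have [m [l [m0 l0 mt lm lt]]] := deviation_parameters kap_gt0 tk.
(* If [N < 2 * m], then [t ^+ 2 >= 64 * kap ^+ 2 * m > 9 * kap ^+ 2 * N]: beyond the oscillation of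
   [f], the event is empty. *)
have [Nm|mN] := ltnP N (2 * m).
  rewrite -/(deviation t) dev_eq0 ?mulr_ge0 ?expR_ge0//.
  rewrite -(@ltr_pXn2r _ 2) ?nnegrE ?mulr_ge0 ?sqrtr_ge0 ?ltW//.
  rewrite !exprMn sqr_sqrtr//.
  have : N%:R < 2 * m%:R :> R by rewrite -natrM ltr_nat.
  have : 0 < kap ^+ 2 by rewrite exprn_gt0.
  by move: mt; set k2 := kap ^+ 2; nra.
have [n1 [n2 [eN n21 n10 N3]]] : exists n1 n2,
    [/\ (n1 + (n2 + m) = N)%N, (n1 <= n2 + m)%N, (0 < n1)%N & (N <= 3 * n1)%N].
  clear -mN m0; exists N./2, (N - N./2 - m)%N; split; lia.
have N1 : (1 < N)%N by clear -mN m0; lia.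
set E := expect N f [::].
pose a s1 s2 := expect m f s2 - expect (n2 + m) f s1.
pose b s1 := expect (n2 + m) f s1 - E.
pose W s1 s2 := expR (l * a s1 s2) + expR (- l * a s1 s2) +
  (expR (l * b s1) + expR (- l * b s1)).
have sqrt_m : 2 * kap * Num.sqrt m%:R <= t / 4.
  have h1 : 0 <= 2 * kap * Num.sqrt m%:R by rewrite !mulr_ge0 ?sqrtr_ge0// ltW.
  have h2 : 0 <= t / 4 by lra.
  by rewrite -(@ler_pXn2r _ 2)// expr_div_n !exprMn sqr_sqrtr//; lra.
have bound s1 s2 : s2 != [::] ->
    expect m (deviation t) s2 <= expR (- (l * t / 4)) * W s1 s2.
  move=> s20; rewrite -[leRHS](expect_cst Q_gt0 m _ s2).
  apply: expect_le_cat => t3 st3; rewrite /deviation -/E.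
  case: (lerP t `|f (t3 ++ s2) - E|) => [tf|_] /=; last first.
    by rewrite mulr_ge0 ?addr_ge0 ?expR_ge0.
  have /andP[h1 h2] := expect_f_cat m s20; have /andP[h3 h4] := f_cat t3 s20.
  rewrite st3 in h4; apply: one_le_sum_expR l0 _.
  have -> : a s1 s2 + b s1 = f (t3 ++ s2) - E + (expect m f s2 - f (t3 ++ s2)).
    by rewrite /a /b; ring.
  have : `|expect m f s2 - f (t3 ++ s2)| <= t / 4.
    by rewrite ler_norml; lra.
  have := lerB_normD (f (t3 ++ s2) - E) (expect m f s2 - f (t3 ++ s2)).
  by lra.
rewrite -/(deviation t) -[X in expect X _ _]eN expect_comp.
apply: (@le_trans _ _ (expect n1 (fun s1 => expect n2 (fun s2 =>
   expR (- (l * t / 4)) * W s1 s2) s1) [::])).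
  apply: expect_le_cat => s1 st1; rewrite cats0 expect_comp.
  apply: expect_le_cat => s2 st2; apply: bound.
  by rewrite -size_eq0 size_cat st1 -lt0n ltn_addl.
rewrite (@eq_expect _ _ _ _ (fun s1 => expR (- (l * t / 4)) *
  (expect n2 (fun s2 => expR (l * a s1 s2)) s1 +
   expect n2 (fun s2 => expR (- l * a s1 s2)) s1 +
   (expR (l * b s1) + expR (- l * b s1))))); last first.
  by move=> s1; rewrite expectZ !expectD !expect_cst.
rewrite expectZ !expectD.
set z := l ^+ 2 * kap ^+ 2 in lm lt *.
have second_half (l' : R) : l' ^+ 2 = l ^+ 2 ->
    expect n1 (fun s1 => expect n2 (fun s2 => expR (l' * a s1 s2)) s1) [::] <=
    expR (258 * z).
  by move=> ll; rewrite /z -ll; apply: expect_expR_second_half; rewrite ?ll.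
have first_half (l' : R) : l' ^+ 2 = l ^+ 2 ->
    expect n1 (fun s1 => expR (l' * b s1)) [::] <= expR (258 * z).
  move=> ll; apply: (@le_trans _ _ (expR (46 * z))); last first.
    have z0 : 0 <= z by rewrite /z mulr_ge0 ?sqr_ge0.
    by rewrite ler_expR ler_wpM2r ?ler_nat.
  have eNn1 : (N - n1 = n2 + m)%N by rewrite -eN addKn.
  rewrite /b -eNn1 /z -ll; apply: expect_expR_first_half; rewrite ?eNn1// ?ll.
    by rewrite -eN -[ltnLHS]addn0 ltn_add2l ltn_addl.
  by apply: (le_trans lm); rewrite ler_nat leq_addl.
apply: (@le_trans _ _ (expR (- (l * t / 4)) * (4 * expR (258 * z)))).
  have -> : 4 * expR (258 * z) = expR (258 * z) + expR (258 * z) +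
    (expR (258 * z) + expR (258 * z)) by ring.
  rewrite ler_wpM2l ?expR_ge0//.
  by rewrite !lerD// ?second_half ?first_half ?sqrrN.
by rewrite mulrCA ler_pM2l// -expRD ler_expR addrC.
Qed.

End FiniteConcentration.

(** * The dyadic grid and its cells *)

Section DyadicGrid.
Variables (R : realType) (n : nat).
Let Q : finType := ('I_(2 ^ n) * 'I_(2 ^ n))%type.
Implicit Types (q x y : Q) (s : seq Q) (k : nat).

Definition grid_point q : R * R := (q.1%:R * 2 ^- n, q.2%:R * 2 ^- n).

(** Quotients put each grid point in exactly one cell per level, although the closed dyadic squares
    share edges. *)
Definition grid_cell k q : nat * nat :=
  ((q.1 %/ 2 ^ (n - k))%N, (q.2 %/ 2 ^ (n - k))%N).

Lemma card_grid : #|Q| = (4 ^ n)%N.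
Proof. by rewrite card_prod card_ord -expnMn. Qed.

Lemma card_grid_gt0 : (0 < #|Q|)%N.
Proof. by rewrite card_grid expn_gt0. Qed.

Lemma count_quotient (d m l : nat) : (0 < d)%N -> (l < m)%N ->
  (\sum_(i < m * d) (i %/ d == l)%N = d)%N.
Proof.
move=> d0 lm; rewrite -(big_mkord xpredT (fun i => nat_of_bool (i %/ d == l)%N)).
have h1 : (l * d <= m * d)%N by rewrite leq_mul2r ltnW ?orbT.
have h2 : (l * d <= l.+1 * d)%N by rewrite leq_mul2r leqnSn orbT.
have h3 : (l.+1 * d <= m * d)%N by rewrite leq_mul2r lm orbT.
rewrite (big_cat_nat (n := l * d))//= (big_cat_nat (m := l * d) (n := l.+1 * d))//=.
rewrite big_nat big1 => [|i /andP[_ il]]; last first.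
  by rewrite -ltn_divLR// in il; case: eqP => // e; rewrite e ltnn in il.
rewrite [X in (_ + (_ + X))%N]big_nat [X in (_ + (_ + X))%N]big1 => [|i /andP[li _]]; last first.
  by rewrite -leq_divRL// in li; case: eqP => // e; rewrite e ltnn in li.
rewrite (eq_big_nat _ _ (F2 := fun=> 1%N)) => [|i /andP[li il]].
  by rewrite sum_nat_const_nat muln1 addn0 add0n mulSn addnK.
by apply/eqP; rewrite eqb1 eqn_leq leq_divRL// li andbT -ltnS ltn_divLR.
Qed.

Lemma grid_cell_lt k q : (k <= n)%N ->
  ((grid_cell k q).1 < 2 ^ k)%N /\ ((grid_cell k q).2 < 2 ^ k)%N.
Proof.
move=> kn; rewrite /= !ltn_divLR ?expn_gt0// -!expnD subnKC//.
Qed.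

Lemma avg_grid_cell k q : (k <= n)%N ->
  avg (fun y => (grid_cell k y == grid_cell k q)%:R) = 4 ^- k :> R.
Proof.
move=> kn; have [h1 h2] := grid_cell_lt q kn.
have e : (2 ^ n = 2 ^ k * 2 ^ (n - k))%N by rewrite -expnD subnKC.
have count l : (l < 2 ^ k)%N ->
    (\sum_(i < 2 ^ n) (i %/ 2 ^ (n - k) == l)%N = 2 ^ (n - k))%N.
  by move=> lk; rewrite e count_quotient ?expn_gt0.
rewrite /avg -natr_sum.
have -> : (\sum_y (grid_cell k y == grid_cell k q) = 4 ^ (n - k))%N.
  rewrite -(pair_bigA _ (fun i j => nat_of_bool (grid_cell k (i, j) == grid_cell k q)))/=.
  transitivity ((\sum_(i < 2 ^ n) (i %/ 2 ^ (n - k) == (grid_cell k q).1)) *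
    (\sum_(j < 2 ^ n) (j %/ 2 ^ (n - k) == (grid_cell k q).2)))%N.
    rewrite big_distrlr; apply: eq_bigr => i _; apply: eq_bigr => j _.
    by rewrite /= -mulnb.
  by rewrite !count// -expnMn.
rewrite card_grid !natrX -[in 4 ^+ n](subnK kn) exprD invfM mulrA divff ?mul1r//.
Qed.

Lemma grid_cell0 x y : grid_cell 0 x = grid_cell 0 y.
Proof. by rewrite /grid_cell subn0 !divn_small. Qed.

Lemma grid_point_mem k q : (k <= n)%N ->
  dyadic_square k (grid_cell k q).1 (grid_cell k q).2 (grid_point q).
Proof.
move=> kn; have coord (i : 'I_(2 ^ n)) :
    (i %/ 2 ^ (n - k))%:R * 2 ^- k <= i%:R * 2 ^- n :> R /\
    i%:R * 2 ^- n <= (i %/ 2 ^ (n - k)).+1%:R * 2 ^- k :> R.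
  have e : 2 ^- k = (2 ^ (n - k))%:R * 2 ^- n :> R.
    have e' : (2 : R) ^+ n = 2 ^+ (n - k) * 2 ^+ k by rewrite -exprD subnK.
    by rewrite natrX e' invfM mulrA divff ?mul1r// expf_neq0.
  rewrite e !mulrA -!natrM !ler_pM2r ?invr_gt0 ?exprn_gt0// !ler_nat.
  by split; [exact: leq_trunc_div|rewrite ltnW// ltn_ceil// expn_gt0].
have [h1 h2] := coord q.1; have [h3 h4] := coord q.2.
by split; rewrite /= in_itv/=; apply/andP.
Qed.

End DyadicGrid.

(** * Geometry of dyadic squares *)

Section Geometry.
Variable R : realType.

Lemma dyadic_square_sub k l1 l2 : (l1 < 2 ^ k)%N -> (l2 < 2 ^ k)%N ->
  (dyadic_square k l1 l2 `<=` @unit_square R)%classic.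
Proof.
move=> h1 h2 [a b] /= []; rewrite /= !in_itv/= => /andP[a1 a2] /andP[b1 b2].
have aux l (c : R) : (l < 2 ^ k)%N -> l%:R * 2 ^- k <= c -> c <= l.+1%:R * 2 ^- k ->
    0 <= c <= 1.
  move=> lk c1 c2; rewrite (le_trans _ c1) ?mulr_ge0 ?invr_ge0 ?exprn_ge0//=.
  by rewrite (le_trans c2)// ler_pdivrMr ?exprn_gt0// mul1r -natrX ler_nat.
by split; rewrite /= in_itv/=; [apply: (aux l1)|apply: (aux l2)].
Qed.

Lemma dyadic_squaresP k l1 l2 : (l1 < 2 ^ k)%N -> (l2 < 2 ^ k)%N ->
  dyadic_squares k (@dyadic_square R k l1 l2).
Proof. by move=> h1 h2; exists (Ordinal h1), (Ordinal h2). Qed.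

Lemma eucl_distxx (p : R * R) : eucl_dist p p = 0.
Proof. by rewrite /eucl_dist !subrr expr0n addr0 sqrtr0. Qed.

(** Since [2 = 4 * 2 ^- 1], the proximity condition of [regular] is automatic at level 1. *)
Lemma eucl_dist_unit_square (p q : R * R) :
  unit_square p -> unit_square q -> eucl_dist p q <= 2.
Proof.
case: p q => [a b] [c d] []; rewrite /= !in_itv/= => /andP[a0 a1] /andP[b0 b1].
case; rewrite /= !in_itv/= => /andP[c0 c1] /andP[d0 d1].
have -> : 2 = Num.sqrt (2 ^+ 2) :> R by rewrite sqrtr_sqr normr_nat.
by rewrite /eucl_dist/= ler_wsqrtr//; nra.
Qed.

End Geometry.

(** * The functional restricted to grid points *)

Section GridFunctional.
Variables (R : realType) (kap : R) (L : {fset R * R} -> R) (n : nat).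
Hypothesis kap_gt0 : 0 < kap.
Hypothesis L_reg : regular kap L.
Hypothesis n_gt0 : (0 < n)%N.
Let Q : finType := ('I_(2 ^ n) * 'I_(2 ^ n))%type.
Implicit Types (q x y : Q) (s : seq Q) (k : nat).

Definition grid_set s : {fset R * R} := [fset grid_point R x | x in s]%fset.

Definition grid_functional s : R := L (grid_set s).

Lemma grid_point_unit_square q : unit_square (grid_point R q).
Proof.
have [h1 h2] := grid_cell_lt q (leqnn n).
exact: dyadic_square_sub h1 h2 _ (grid_point_mem R q (leqnn n)).
Qed.

Lemma grid_set_unit_square s : ([set` grid_set s] `<=` @unit_square R)%classic.
Proof. by move=> p /imfsetP[x _ ->]; exact: grid_point_unit_square. Qed.

Lemma grid_set_cat t s : grid_set (t ++ s) = (grid_set s `|` grid_set t)%fset.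
Proof.
apply/fsetP => p; rewrite in_fsetU; apply/imfsetP/orP => /=.
  move=> [x]; rewrite mem_cat => /orP[xt|xs] ->; [right|left]; exact: in_imfset.
by move=> [] /imfsetP[/= x xs ->]; exists x; rewrite // mem_cat xs ?orbT.
Qed.

Lemma grid_functional_set_invariant : set_invariant grid_functional.
Proof.
move=> s s' ss'; congr L; apply/fsetP => p.
by apply/imfsetP/imfsetP => -[x xs ->]; exists x; rewrite //= ?ss' // -ss'.
Qed.

Lemma size_grid_set t : (#|` grid_set t| <= size t)%N.
Proof.
rewrite -(size_map (@grid_point R n)); apply: uniq_leq_size (fset_uniq _) _.
by move=> _ /imfsetP[/= x xt ->]; exact: map_f.
Qed.

Lemma grid_functional_cell_cat k c s t : (0 < k <= n)%N ->
    {in t, forall x, grid_cell k x = c} -> (c.1 < 2 ^ k)%N -> (c.2 < 2 ^ k)%N ->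
    (exists2 y, y \in s & exists2 p, @dyadic_square R k c.1 c.2 p &
      eucl_dist (grid_point R y) p <= 4 * 2 ^- k) ->
  grid_functional s <= grid_functional (t ++ s) <=
    grid_functional s + kap * 2 ^- k * Num.sqrt (size t)%:R.
Proof.
move=> /andP[k0 kn] tc c1 c2 [y ys [p cp yp]].
have [] := @L_reg (grid_set s) (grid_set t) k _ (@grid_set_unit_square s) k0
  (dyadic_squaresP R c1 c2).
- move=> _ /imfsetP[/= x xt ->]; rewrite -(tc x xt).
  exact: grid_point_mem.
- by exists (grid_point R y); [exact: in_imfset|exists p].
rewrite -grid_set_cat => -> /= h; apply: (le_trans h); rewrite lerD2l.
rewrite ler_wpM2l ?mulr_ge0 ?invr_ge0 ?exprn_ge0//; first exact: ltW.
by rewrite ler_wsqrtr// ler_nat size_grid_set.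
Qed.

Lemma grid_functional_cat_level1 c s t : s != [::] ->
    {in t, forall x, grid_cell 1 x = c} -> (c.1 < 2)%N -> (c.2 < 2)%N ->
  grid_functional s <= grid_functional (t ++ s) <=
    grid_functional s + kap / 2 * Num.sqrt (size t)%:R.
Proof.
case: s => // y s _ tc c1 c2; case: t tc => [_|x t tc].
  by rewrite lexx lerDl mulr_ge0 ?sqrtr_ge0// ltW// divr_gt0.
have := @grid_functional_cell_cat 1 c (y :: s) (x :: t).
rewrite expr1; apply => //; exists y; first exact: mem_head.
exists (grid_point R x).
  by rewrite -(tc x (mem_head _ _)); exact: grid_point_mem.
rewrite (le_trans (eucl_dist_unit_square _ _)) ?expr1//.
- exact: grid_point_unit_square.
- exact: grid_point_unit_square.
- lra.
Qed.

Lemma grid_functional_cons k x s : (k <= n)%N ->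
    has (fun y => grid_cell k y == grid_cell k x) s ->
  grid_functional s <= grid_functional (x :: s) <= grid_functional s + kap * 2 ^- k.
Proof.
have x1 k' : {in [:: x], forall y, grid_cell k' y = grid_cell k' x}.
  by move=> y; rewrite inE => /eqP ->.
(* [regular] starts at level 1; level 0 follows from the level-1 bound [kap / 2]. *)
case: k => [_ h|k kn /hasP[y ys /eqP yx]].
  have s0 : s != [::] by case: s h.
  have [c1 c2] := @grid_cell_lt n 1 x n_gt0.
  have := @grid_functional_cat_level1 _ s [:: x] s0 (x1 1%N) c1 c2.
  rewrite sqrtr1 expr0 => /andP[-> /= h2]; apply: (le_trans h2).
  by rewrite lerD2l; have := kap_gt0; lra.
have [c1 c2] := grid_cell_lt x kn.
have := @grid_functional_cell_cat k.+1 _ s [:: x] _ (x1 k.+1) c1 c2.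
rewrite sqrtr1 mulr1; apply; first by [].
exists y => //; exists (grid_point R y).
  by rewrite -yx; exact: grid_point_mem.
by rewrite eucl_distxx mulr_ge0 ?invr_ge0 ?exprn_ge0.
Qed.

(** The points of [t] are added one level-1 square at a time; each of the four groups costs at most
    [kap / 2] times the square root of [size t]. *)
Lemma grid_functional_cat t s : s != [::] ->
  grid_functional s <= grid_functional (t ++ s) <=
    grid_functional s + 2 * kap * Num.sqrt (size t)%:R.
Proof.
move=> s0; pose cs : seq (nat * nat) := [:: (0, 0); (0, 1); (1, 0); (1, 1)]%N.
pose part (cs : seq (nat * nat)) :=
  flatten [seq [seq x <- t | grid_cell 1 x == c] | c <- cs].
have step l : {in l, forall c, (c.1 < 2)%N && (c.2 < 2)%N} ->
    grid_functional s <= grid_functional (part l ++ s) <=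
    grid_functional s + (size l)%:R * (kap / 2 * Num.sqrt (size t)%:R).
  elim: l => [|c l IH] hl; first by rewrite mul0r addr0 lexx.
  have /andP[h1 h2] := IH (fun d dl => hl d (@mem_behead _ (c :: l) d dl)).
  have /andP[c1 c2] := hl c (mem_head _ _).
  have l0 : part l ++ s != [::] by case: (part l).
  have tc : {in [seq x <- t | grid_cell 1 x == c], forall x, grid_cell 1 x = c}.
    by move=> x; rewrite mem_filter => /andP[/eqP].
  have /andP[] := grid_functional_cat_level1 l0 tc c1 c2.
  rewrite catA => h3 h4; apply/andP; split; first exact: le_trans h3.
  apply: (le_trans h4); rewrite /= -(natr1 (size l)) mulrDl mul1r addrA lerD// ler_pM2l ?divr_gt0//.
  by rewrite ler_wsqrtr// ler_nat size_filter count_size.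
have cs2 : {in cs, forall c, (c.1 < 2)%N && (c.2 < 2)%N}.
  by apply/allP.
have /andP[] := step cs cs2.
have -> : grid_functional (part cs ++ s) = grid_functional (t ++ s).
  apply: grid_functional_set_invariant => x; rewrite mem_cat [RHS]mem_cat; congr (_ || _).
  apply/flatten_mapP/idP => [[c _]|xt]; first by rewrite mem_filter => /andP[].
  exists (grid_cell 1 x); last by rewrite mem_filter eqxx.
  have [] := @grid_cell_lt n 1 x n_gt0; case: (grid_cell 1 x) => a b /=.
  by move: a b => [|[|a]] [|[|b]].
move=> -> h /=; apply: (le_trans h).
by rewrite lerD2l /cs /=; set r := Num.sqrt _; lra.
Qed.

End GridFunctional.

Local Open Scope classical_set_scope.
Local Open Scope ring_scope.

(** * Rounding points to the grid *)

Section Discretization.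
Variables (R : realType) (kap : R) (L : {fset R * R} -> R).
Hypothesis kap_gt0 : 0 < kap.
Hypothesis L_reg : regular kap L.

(** [J] is the least exponent with [N <= 4 ^ J]. The grid level [n] does not enter the bound, so the
    grid can be refined at will. *)
Lemma grid_concentration n N : (0 < n)%N -> (0 < N)%N -> (up_log 4 N <= n)%N ->
  exists E : R, forall t : R, 8 * kap <= t ->
    #|[pred q : N.-tuple ('I_(2 ^ n) * 'I_(2 ^ n)) |
        (t <= `|grid_functional L q - E|)%R]|%:R / (4 ^ n) ^+ N <=
    4 * expR (- (t ^+ 2 / (16512 * kap ^+ 2))).
Proof.
move=> n0 N0 Jn; set J := up_log 4 N in Jn.
have N_le : (N <= 4 ^ J)%N by exact: up_logP.
have le_N : (4 ^ J <= 4 * N)%N.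
  case: (ltnP 1 N) => [N1|].
    have /andP[h _] := up_log_bounds (isT : 1 < 4)%N N1.
    by move: h; rewrite -/J; case: (J) => [|j] /= h; rewrite ?expn0 ?expnS; lia.
  by rewrite /J => N1; have -> : N = 1%N by lia.
set f := @grid_functional R L n.
have f_inv : set_invariant f by exact: grid_functional_set_invariant.
exists (expect N f [::]) => t tk.
have := @finite_concentration R _ _ (@grid_cell n) J N kap f (card_grid_gt0 n)
  (fun k q kJ => avg_grid_cell R q (leq_trans kJ Jn)) (@grid_cell0 n) kap_gt0 f_inv
  (fun k x s kJ => grid_functional_cons kap_gt0 L_reg n0 (leq_trans kJ Jn))
  (grid_functional_cat kap_gt0 L_reg n0) N0 N_le le_N t tk.
rewrite expect_tuple; last by move=> s s' ss'; rewrite (f_inv _ _ ss').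
apply: le_trans; rewrite card_grid !natrX ler_pM2r ?invr_gt0 ?exprn_gt0//.
rewrite -sum1_card natr_sum big_mkcond/=; apply: ler_sum => q _.
by rewrite cats0 -/f inE; case: ifP.
Qed.

Lemma close_points_le n (F : {fset R * R}) (s : seq (R * R)) : (0 < n)%N ->
    [set` F] `<=` @unit_square R ->
    (forall p, p \in s -> exists2 q, q \in F & exists2 C, dyadic_squares n C & C p /\ C q) ->
  L F <= L (F `|` [fset p in s])%fset <= L F + (size s)%:R * (kap * 2 ^- n).
Proof.
move=> n0 FU; elim: s => [|p s IH] hs.
  have -> : (F `|` [fset p in [::]] = F)%fset.
    by apply/fsetP => x; rewrite !inE orbF.
  by rewrite mul0r addr0 lexx.
have /andP[h1 h2] : L F <= L (F `|` [fset p in s])%fset <= L F + (size s)%:R * (kap * 2 ^- n).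
  by apply: IH => p' ps; apply: hs; rewrite inE ps orbT.
have [q qF [C Cn [Cp Cq]]] := hs p (mem_head _ _).
have FsU : [set` (F `|` [fset p in s])%fset] `<=` @unit_square R.
  move=> x /=; rewrite !inE => /orP[/FU//|xs].
  have [|_ _ [D [l1 [l2 ->]] [Dx _]]] := hs x; first by rewrite inE xs orbT.
  exact: dyadic_square_sub (ltn_ord l1) (ltn_ord l2) _ Dx.
have GC : [set` [fset p]%fset] `<=` C by move=> x /=; rewrite inE => /eqP ->.
have [|h3 h4] := @L_reg (F `|` [fset p in s])%fset [fset p]%fset n C FsU n0 Cn GC.
  exists q; first by rewrite !inE qF.
  by exists q; rewrite ?eucl_distxx ?mulr_ge0 ?invr_ge0 ?exprn_ge0.
have e : (F `|` [fset p0 in p :: s] = (F `|` [fset p in s]) `|` [fset p])%fset.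
  by apply/fsetP => x; rewrite !inE -orbA [(x == p) || _]orbC.
rewrite e (le_trans h1 h3)/=; apply: (le_trans h4).
by rewrite cardfs1 sqrtr1 mulr1 /= -(natr1 (size s)) mulrDl mul1r addrA lerD2r.
Qed.

(** Through the union of the two sets: reaching it from [x] does not lower [L], and reaching it from
    [y] adds [N] points, each in a level-[n] square of a point already present. *)
Lemma close_point_sets_le n N (x y : 'I_N -> R * R) : (0 < n)%N ->
    (forall i, exists2 C, dyadic_squares n C & C (x i) /\ C (y i)) ->
  L (point_set x) <= L (point_set y) + N%:R * (kap * 2 ^- n).
Proof.
move=> n0 xy.
have xU i : unit_square (x i) /\ unit_square (y i).
  have [D [l1 [l2 ->]] [Dx Dy]] := xy i.
  by split; apply: dyadic_square_sub (ltn_ord l1) (ltn_ord l2) _ _.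
have pU z : (forall i : 'I_N, unit_square (z i)) -> [set` point_set z] `<=` @unit_square R.
  by move=> zU _ /imfsetP[i _ ->].
pose s (z : 'I_N -> R * R) := [seq z i | i <- enum 'I_N].
have sE z : (point_set z = [fset p in s z])%fset.
  apply/fsetP => p; rewrite !inE; apply/imfsetP/mapP => -[i _ ->]; exists i => //.
  by rewrite mem_enum.
have ss z : size (s z) = N by rewrite size_map size_enum_ord.
have /andP[h1 _] : L (point_set x) <= L (point_set x `|` [fset p in s y])%fset <=
    L (point_set x) + (size (s y))%:R * (kap * 2 ^- n).
  apply: close_points_le => //; first by apply: pU => i; case: (xU i).
  move=> _ /mapP[i _ ->]; have [C Cn [Cx Cy]] := xy i.
  by exists (x i); [exact: in_imfset|exists C].
have /andP[_ h2] : L (point_set y) <= L (point_set y `|` [fset p in s x])%fset <=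
    L (point_set y) + (size (s x))%:R * (kap * 2 ^- n).
  apply: close_points_le => //; first by apply: pU => i; case: (xU i).
  move=> _ /mapP[i _ ->]; have [C Cn [Cx Cy]] := xy i.
  by exists (y i); [exact: in_imfset|exists C].
by rewrite -sE fsetUC in h1; rewrite -sE ss in h2; exact: le_trans h2.
Qed.

End Discretization.

(** * Probability that the sample falls in given grid squares *)

Section GridLaw.
Variables (R : realType) (n N : nat).
Let Q : finType := ('I_(2 ^ n) * 'I_(2 ^ n))%type.

Definition grid_square (q : Q) : set (R * R) := dyadic_square n q.1 q.2.

Lemma grid_square_cover (p : R * R) : unit_square p -> exists q : Q, grid_square q p.
Proof.
have cover1 (a : R) : 0 <= a <= 1 -> exists l : 'I_(2 ^ n),
    l%:R * 2 ^- n <= a <= l.+1%:R * 2 ^- n.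
  move=> /andP[a0 a1]; have n2 : 0 < (2 : R) ^+ n by rewrite exprn_gt0.
  have := truncn_itv (mulr_ge0 a0 (ltW n2)); set l := Num.truncn _ => /andP[l1 l2].
  case: (ltnP l (2 ^ n)) => [ll|ll].
    by exists (Ordinal ll); rewrite /= ler_pdivrMr// ler_pdivlMr// l1 ltW.
  (* Only [a = 1] arises here; it goes to the last interval. *)
  have h : ((2 ^ n).-1 < 2 ^ n)%N by rewrite prednK ?expn_gt0.
  exists (Ordinal h); rewrite /= prednK ?expn_gt0// natrX divff ?lt0r_neq0// a1 andbT.
  rewrite ler_pdivrMr// (le_trans _ l1)// ler_nat (leq_trans _ ll)//.
  exact: leq_pred.
case: p => a b [] /=; rewrite !in_itv/= => /cover1[i hi] /cover1[j hj].
by exists (i, j); split; rewrite /= in_itv.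
Qed.

Lemma measurable_grid_square q : measurable (grid_square q).
Proof. by apply: measurableX; exact: measurable_itv. Qed.

Lemma grid_square_area q :
  (@lebesgue_measure R \x @lebesgue_measure R)%E (grid_square q) = (4 ^- n)%:E.
Proof.
have side (l : nat) : @lebesgue_measure R `[l%:R * 2 ^- n, l.+1%:R * 2 ^- n] = (2 ^- n)%:E.
  rewrite lebesgue_measure_itv/= lte_fin ltr_pM2r ?invr_gt0 ?exprn_gt0//.
  by rewrite ltr_nat ltnSn -EFinD -(natr1 l) mulrDl mul1r addrAC subrr add0r.
rewrite /grid_square /dyadic_square product_measure1E; last 2 first.
- exact: measurable_itv.
- exact: measurable_itv.
transitivity ((2 ^- n)%:E * (2 ^- n)%:E : \bar R)%E.
  by congr (_ * _)%E; exact: side.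
rewrite -EFinM -invfM -exprMn; congr ((_ ^+ _)^-1)%:E.
by rewrite -natrM.
Qed.

(** Closed squares overlap on edges, so [q] is not determined by [w]; a union bound over [S]
    suffices, each product of squares having probability [(4 ^ n) ^- N] by independence. *)
Lemma probability_grid_le d (T : measurableType d) (P : probability T R)
    (X : 'I_N -> {RV P >-> (R * R)%type}) (A : set T)
    (S : pred (N.-tuple Q)) :
    mutually_independent X -> (forall i, uniform_on_unit_square (X i)) ->
    measurable A ->
    (forall w, A w -> exists2 q, S q & forall i, grid_square (tnth q i) (X i w)) ->
  (P A <= (#|S|%:R / (4 ^ n) ^+ N)%:E)%E.
Proof.
move=> indep unif mA AS.
pose B (q : N.-tuple Q) := \bigcap_(i in [set` [set: 'I_N]%SET])
   (X i @^-1` grid_square (tnth q i)).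
have mB q : measurable (B q).
  apply: fin_bigcap_measurable => // i _.
  rewrite -[X in measurable X]setTI; apply: measurable_funPT => //.
  exact: measurable_grid_square.
have PB q : P (B q) = ((4 ^ n) ^- N)%:E.
  rewrite /B indep; last by move=> i _; exact: measurable_grid_square.
  rewrite (eq_bigr (fun=> (4 ^- n)%:E)) => [|i _].
    rewrite prodEFin prodr_const cardsT card_ord exprVn.
    by [].
  transitivity (distribution P (X i) (grid_square (tnth q i))); first by [].
  rewrite (unif i).2; last exact: measurable_grid_square.
  rewrite setIidl ?grid_square_area//.
  exact: dyadic_square_sub (ltn_ord _) (ltn_ord _).
have mU (r : seq (N.-tuple Q)) : measurable (\big[setU/set0]_(q <- r) B q).
  exact: bigsetU_measurable.
have PU (r : seq (N.-tuple Q)) :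
    (P (\big[setU/set0]_(q <- r) B q) <= ((size r)%:R / (4 ^ n) ^+ N)%:E)%E.
  elim: r => [|q r IH]; first by rewrite big_nil measure0 mul0r.
  rewrite big_cons; apply: (le_trans (measureU2 _ _ _)) => //.
  rewrite /= -(natr1 (size r)) mulrDl mul1r EFinD addeC; apply: leeD; last exact: IH.
  by rewrite -(PB q) lexx.
rewrite cardE; apply: le_trans (PU (enum S)).
apply: le_measure; rewrite ?inE//= => w /AS[q qS Xq].
rewrite -bigcup_seq; exists q; first by rewrite /= mem_enum.
by move=> i _; exact: Xq.
Qed.

End GridLaw.

(** * Deviation of [L_N] about a center *)

Section Concentration.
Variables (R : realType) (kap : R) (L : {fset R * R} -> R) (N : nat).
Hypothesis kap_gt0 : 0 < kap.
Hypothesis L_reg : regular kap L.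
Hypothesis N_gt0 : (0 < N)%N.
Variables (d : measure_display) (T : measurableType d) (P : probability T R).
Variable X : 'I_N -> {RV P >-> (R * R)%type}.
Hypothesis X_indep : mutually_independent X.
Hypothesis X_unif : forall i, uniform_on_unit_square (X i).

Let L_N w := L (point_set (fun i => X i w)).

(** The grid is so fine that rounding changes [L_N] by at most 1, the slack in [t + 1]. [A] is
    arbitrary in order to cover both the deviation event and the half-lines defining the median. *)
Lemma concentration_about_center : exists E : R,
  forall (t : R) (A : set T), 8 * kap <= t -> measurable A ->
    (forall w, A w -> t + 1 <= `|L_N w - E|) ->
  (P A <= (4 * expR (- (t ^+ 2 / (16512 * kap ^+ 2))))%:E)%E.
Proof.
have Nk0 : 0 <= N%:R * kap by rewrite mulr_ge0// ltW.
have [n [n0 Jn fine]] : exists n,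
    [/\ (0 < n)%N, (up_log 4 N <= n)%N & N%:R * (kap * 2 ^- n) <= 1].
  (* [m.+1] exceeds [N%:R * kap], and [2 ^ n] exceeds [m.+1]. *)
  pose m := Num.truncn (N%:R * kap); exists (up_log 4 N + m.+1)%N.
  split; [by rewrite addnS|exact: leq_addr|].
  have /andP[_ h] := truncn_itv Nk0.
  rewrite mulrA ler_pdivrMr ?exprn_gt0// mul1r (le_trans (ltW h))//.
  rewrite -natrX ler_nat -/m; apply: (leq_trans (leq_addl (up_log 4 N) _)).
  by rewrite ltnW// ltn_expl.
have [E hE] := grid_concentration kap_gt0 L_reg n0 N_gt0 Jn.
exists E => t A tk mA AE.
pose S : pred (N.-tuple ('I_(2 ^ n) * 'I_(2 ^ n))) :=
  [pred q : N.-tuple ('I_(2 ^ n) * 'I_(2 ^ n)) | (t <= `|grid_functional L q - E|)%R].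
apply: (@le_trans _ _ (#|S|%:R / (4 ^ n) ^+ N)%:E); last by rewrite lee_fin hE.
apply: probability_grid_le X_indep X_unif mA _ => w Aw.
have [q Xq] : {q : 'I_N -> _ & forall i, @grid_square R n (q i) (X i w)}.
  apply: (choice (P := fun i q => @grid_square R n q (X i w))) => i.
  by apply: grid_square_cover; exact: (X_unif i).1.
exists [tuple q i | i < N]; last by move=> i; rewrite tnth_mktuple.
rewrite /S /=.
have -> : grid_functional L [tuple q i | i < N] =
    L (point_set (fun i => grid_point R (q i))).
  congr L; apply/fsetP => p; apply/imfsetP/imfsetP => /= -[].
    by move=> x /mapP[i _ ->] ->; exists i.
  by move=> i _ ->; exists (q i) => //; apply/mapP; exists i; rewrite ?mem_enum.
have cell i : dyadic_squares n (@grid_square R n (q i)).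
  by exists (q i).1, (q i).2.
have gq i : grid_square (q i) (grid_point R (q i)).
  by have := grid_point_mem R (q i) (leqnn n); rewrite /grid_cell subnn !divn1.
have h1 := close_point_sets_le L_reg (x := fun i => X i w)
  (y := fun i => grid_point R (q i)) n0
  (fun i => ex_intro2 _ _ _ (cell i) (conj (Xq i) (gq i))).
have h2 := close_point_sets_le L_reg (y := fun i => X i w)
  (x := fun i => grid_point R (q i)) n0
  (fun i => ex_intro2 _ _ _ (cell i) (conj (gq i) (Xq i))).
have := AE w Aw; rewrite -/(L_N w) in h1 h2; move: h1 h2 fine.
set a := L_N w; set b := L _; set c := N%:R * _ => h1 h2 fine.
have : `|a - b| <= 1 by rewrite ler_norml; lra.
have := ler_normD (a - b) (b - E); rewrite addrA subrK; lra.
Qed.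

Lemma measurable_unit_square_functional : measurable_functional N L ->
  measurable_fun setT L_N.
Proof.
move=> mL; pose g w := [tuple X i w | i < N].
have -> : L_N = (fun x : N.-tuple (R * R) => L (point_set (tnth x))) \o g.
  by apply: funext => w; congr (L (point_set _)); apply: funext => i; rewrite tnth_mktuple.
apply: measurable_comp mL _.
- have -> : [set x : N.-tuple (R * R) | forall i, unit_square (tnth x i)] =
      \bigcap_(i in [set: 'I_N]) ((fun x => tnth x i) @^-1` @unit_square R).
    by apply/seteqP; split=> [x h i _|x h i]; exact: h.
  apply: fin_bigcap_measurable => // i _; rewrite -[X in measurable X]setTI.
  apply: measurable_tnth => //.
  by apply: measurableX; exact: measurable_itv.
- by move=> _ [w _ <-] i; rewrite tnth_mktuple; exact: (X_unif i).1.
- apply/measurable_fun_tnthP => i.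
  rewrite (_ : _ \o _ = X i)//; apply: funext => w /=; exact: tnth_mktuple.
Qed.

End Concentration.

(** * From the center to the median *)

Lemma regular_le (R : realType) (kappa kap : R) (L : {fset R * R} -> R) :
  kappa <= kap -> regular kappa L -> regular kap L.
Proof.
move=> kk hL F G k C FU k1 Ck GC near; have [h1 h2] := hL F G k C FU k1 Ck GC near.
split=> //; apply: (le_trans h2); rewrite lerD2l ler_wpM2r ?sqrtr_ge0//.
by rewrite ler_wpM2r// invr_ge0 exprn_ge0.
Qed.

(** [u] puts the tail below one half, which locates the median near the center. [K] absorbs the
    halving of [t] when [t] is large and makes the bound trivial when it is small. *)
Lemma gaussian_tail_constants (R : realType) (kap B : R) : 0 < kap -> 0 < B ->
  exists u K : R, [/\ 8 * kap <= u, 4 * expR (- (u ^+ 2 / B)) < 2^-1, 0 < K,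
    forall t, 2 * (u + 2) <= t ->
      4 * expR (- ((t / 2) ^+ 2 / B)) <= K * expR (- t ^+ 2 / K) &
    forall t, 0 <= t < 2 * (u + 2) -> 1 <= K * expR (- t ^+ 2 / K)].
Proof.
move=> kap0 B0; pose u := 8 * kap + 8 * B + 1.
have u0 : 1 <= u by rewrite /u; lra.
pose K := (2 * (u + 2)) ^+ 2 + 4 * B + 5.
have K4B : 4 * B + 5 <= K by have := sqr_ge0 (2 * (u + 2)); rewrite /K; lra.
exists u, K; split; [rewrite /u; lra| |lra| |].
(* [u >= 8 * B + 1] gives the exponent 8, and [4 * expR (- 8) <= 4 / 9]. *)
- have h8 : 8 <= u ^+ 2 / B by rewrite ler_pdivlMr// /u; nra.
  have : expR (- (u ^+ 2 / B)) <= expR (- 8) by rewrite ler_expR lerN2.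
  have := expRN_le_inv (ler0n R 8).
  have -> : (1 + 8 : R) = 9 by lra.
  by lra.
- move=> t tu; rewrite ler_pM ?expR_ge0//; first lra.
  have -> : (t / 2) ^+ 2 / B = t ^+ 2 / (4 * B).
    by field; rewrite lt0r_neq0.
  rewrite ler_expR mulNr lerN2 ler_wpM2l ?sqr_ge0// lef_pV2 ?posrE; lra.
- move=> t /andP[t0 tu]; have K0 : 0 < K by lra.
  (* The middle term is [K - t ^+ 2], at least 1 by the choice of [K]. *)
  apply: (@le_trans _ _ (K * (1 + - t ^+ 2 / K))); last first.
    by rewrite ler_pM2l// expR_ge1Dx.
  rewrite mulrDr mulr1 mulrCA divff ?lt0r_neq0// mulr1.
  have : t ^+ 2 <= (2 * (u + 2)) ^+ 2 by rewrite lerXn2r ?nnegrE//; lra.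
  by rewrite /K; lra.
Qed.

Theorem theorem11p2p2 (R : realType) (kappa : R) :
  exists K : R, 0 < K /\
  forall L : {fset R * R} -> R,
    regular kappa L ->
  forall N : nat, (1 <= N)%N ->
    measurable_functional N L ->
  forall (d : measure_display) (T : measurableType d) (P : probability T R)
    (X : 'I_N -> {RV P >-> (R * R)%type}),
    mutually_independent X ->
    (forall i, uniform_on_unit_square (X i)) ->
  forall (M : R),
    let L_N := fun w : T => L (point_set (fun i => X i w)) in
    is_median P L_N M ->
  forall t : R, 0 <= t ->
    (P [set w | (t <= `|L_N w - M|)%R] <= (K * expR (- t ^+ 2 / K))%:E)%E.
Proof.
pose kap := `|kappa| + 1.
have kap0 : 0 < kap by rewrite ltr_wpDl.
have kk : kappa <= kap by rewrite (le_trans (ler_norm _))// lerDl.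
have [B [B0 BE]] : exists B, 0 < B /\ B = 16512 * kap ^+ 2.
  exists (16512 * kap ^+ 2); split; last reflexivity.
  have k20 : 0 < kap ^+ 2 by rewrite exprn_gt0.
  lra.
have [u [K [uk uhalf K0 Kbig Ksmall]]] := gaussian_tail_constants kap0 B0.
exists K; split=> // L Lreg N N1 mL d T P X indep unif M LN [medl medr] t t0.
have mLN : measurable_fun setT LN := measurable_unit_square_functional unif mL.
have mle (f g : T -> R) : measurable_fun setT f -> measurable_fun setT g ->
    measurable [set w | f w <= g w].
  by move=> mf mg; rewrite -[X in measurable X]setTI; exact: measurable_fun_le.
have mcst (a : R) : measurable_fun [set: T] (fun=> a) by exact: measurable_cst.
have [E hE] := concentration_about_center kap0 (regular_le kk Lreg) N1 indep unif.
rewrite -BE in hE.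
(* An event of mass at least one half cannot stay at distance [u + 1] from [E]. The two half-lines
   at [M] have such mass, whence [|E - M| <= u + 1]. *)
have far (A : set T) : measurable A -> ((2^-1)%:E <= P A)%E ->
    ~ (forall w, A w -> u + 1 <= `|LN w - E|).
  move=> mA PA /(hE _ _ uk mA) /(le_trans PA); apply/negP.
  by rewrite -ltNge lte_fin.
have ME1 : M <= E + (u + 1).
  rewrite leNgt; apply/negP => h; apply: (far _ (mle _ _ _ _) medr) => // w /= hw.
  by rewrite ler_normr lerBrDl (le_trans (ltW h) hw).
have ME2 : E <= M + (u + 1).
  rewrite leNgt; apply/negP => h; apply: (far _ (mle _ _ _ _) medl) => // w /= hw.
  rewrite ler_normr; apply/orP; right.
  by rewrite opprB lerBrDr addrC (le_trans _ (ltW h))// lerD2r.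
have mA : measurable [set w | t <= `|LN w - M|].
  apply: mle => //; apply: measurableT_comp; first exact: normr_measurable.
  exact: measurable_funB.
(* For large [t], [|LN - E| >= t - (u + 1) >= t / 2 + 1], as [hE] requires at [t / 2]. *)
have [tt|tt] := lerP (2 * (u + 2)) t; last first.
  by apply: (le_trans (probability_le1 _ mA)); rewrite lee_fin Ksmall// t0.
apply: le_trans (hE (t / 2) _ _ mA _) _; last by rewrite lee_fin Kbig.
  by clear -tt uk kap0; lra.
move=> w /= hw; rewrite -/(LN w).
have h1 : `|LN w - M| <= `|LN w - E| + `|E - M|.
  by have := ler_normD (LN w - E) (E - M); rewrite addrA subrK.
have h2 : `|E - M| <= u + 1.
  by rewrite ler_norml; apply/andP; split; [rewrite lerNl opprB|]; rewrite lerBlDl.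
by clear -h1 h2 hw tt; lra.
Qed.
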